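(* Let $q\in\mathbb N_1$ and let $P_\bullet=(P_n)_{n\ge0}$ be a $q$-chromatic partition structure with representing measure $\mu$ on $\boldsymbol\nabla^{(q)}_0$, i.e. $\mu$ is the (unique) Borel probability with $P_n[A]=\int\psi_A\,d\mu$ for all $n\in\mathbb N_0$, $A\in\mathcal A^{(q)}_n$. The following are equivalent: (i) $P_\bullet$ is of partially exchangeable type; (ii) $\mathbf D_\sharp\mu=\delta_{\mathbf p}$ for some $\mathbf p\in\Delta^{q-1}$, where $\mathbf D(\mathbf x)=\sum_{i\ge0}\mathbf x_i$. In this case, $\mathbf p$ is uniquely determined by $p_j=P_1[\mathbf 1_{\mathbf e_j}]$, $j\in[q]$. If, additionally, $\mathbf p\in\mathring\Delta^{q-1}$ (the relative interior of $\Delta^{q-1}$), then the partially exchangeable partition structure $(Q_{\mathbf n})_{\mathbf n}$ in the definition of partially exchangeable type satisfies $$Q_{\mathbf n}[A]=\binom{|\mathbf n|}{\mathbf n}^{-1}\mathbf p^{-\mathbf n}\,P_{|\mathbf n|}[A],\qquad A\in\mathcal A_{\mathbf n},\ \mathbf n\in\mathbb N_0^q .$$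
   Context: Notation: $\mathbb N_1=\{1,2,\dots\}$, $\mathbb N_0=\{0,1,\dots\}$, $[q]=\{1,\dots,q\}$, $\mathbb N^q_*=\mathbb N_0^q\setminus\{\mathbf 0\}$, $0^0=1$; $|\mathbf a|=\sum_j|a_j|$, $\mathbf a!=\prod_ja_j!$, $\mathbf x^{\mathbf a}=\prod_jx_j^{a_j}$, $\binom{|\mathbf n|}{\mathbf n}=|\mathbf n|!/\mathbf n!$; $\mathbf e_j$ canonical basis vectors; $\Delta^{q-1}=\{\mathbf u\in[0,1]^q:|\mathbf u|=1\}$. A $q$-chromatic partition of $n$ is a finitely supported map $A\colon\mathbb N^q_*\to\mathbb N_0$ with $\sum_{\mathbf a}A(\mathbf a)|\mathbf a|=n$; $\mathcal A^{(q)}_n$ is the set of these ($\mathcal A^{(q)}_0=\{0\}$); for $\mathbf n\in\mathbb N_0^q$, $\mathcal A_{\mathbf n}=\{A:\sum_{\mathbf a}A(\mathbf a)\mathbf a=\mathbf n\}$. $\mathbf 1_{\mathbf a}$ is the multiset with single element $\mathbf a$; operations, $\le$ pointwise; $s(A)=\sum_{\mathbf a} A(\mathbf a)$. For $\mathbf a\in\mathrm{supp}A$, $a_j\ge1$: $A_{\setminus\mathbf a,j}=A-\mathbf 1_{\mathbf a}$ if $\mathbf a=\mathbf e_j$, else $A-\mathbf 1_{\mathbf a}+\mathbf 1_{\mathbf a-\mathbf e_j}$. A $q$-chromatic partition structure is a sequence $(P_n)_{n\ge0}$ of probability measures on $\mathcal A^{(q)}_n$ with $P_{n-1}[B]=\sum_{A\in\mathcal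 A^{(q)}_n}P_n[A]S_{n-1,n}(A,B)$, $n\ge1$, where $S_{n-1,n}(A,B)=a_jA(\mathbf a)/n$ if $B=A_{\setminus\mathbf a,j}$, and $0$ otherwise. A partially exchangeable partition structure is a family $(Q_{\mathbf n})_{\mathbf n\in\mathbb N_0^q}$ of probability measures $Q_{\mathbf n}$ on $\mathcal A_{\mathbf n}$ with $Q_{\mathbf n-\mathbf e_j}[B]=\sum_{A\in\mathcal A_{\mathbf n}}Q_{\mathbf n}[A]S^j_{\mathbf n}(A,B)$ for all $\mathbf n$, all $j$ with $n_j\ge1$ and all $B\in\mathcal A_{\mathbf n-\mathbf e_j}$, where $S^j_{\mathbf n}(A,B)=a_jA(\mathbf a)/n_j$ if $B=A_{\setminus\mathbf a,j}$, and $0$ otherwise. $P_\bullet$ is of partially exchangeable type if there are $\mathbf p\in\Delta^{q-1}$ and such a family $(Q_{\mathbf n})$ with $P_n=\sum_{\mathbf n\in\mathbb N_0^q:|\mathbf n|=n}\binom n{\mathbf n}\mathbf p^{\mathbf n}Q_{\mathbf n}$ for all $n\in\mathbb N_0$. Kingman simplex: $\mathbf s<_{\mathrm{sl}}\mathbf t$ iff $(|\mathbf s|,s_1,\dots,s_q)<(|\mathbf t|,t_1,\dots,t_q)$ lexicographically. $\boldsymbol\nabla^{(q)}_0$ is the set of sequences $\mathbf x=(\mathbf x_i)_{i\ge0}$ in $[0,\infty)^q$ with $\mathbf x_i\ge_{\mathrm{sl}}\mathbf x_{i+1}$ for $i\ge1$, $\sum_{i\ge0}|\mathbf x_i|=1$,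 with the Borel $\sigma$-algebra of the product topology. For $A\in\mathcal A^{(q)}_n$ let $(\mathbf a_h)_{h\in[s(A)]}$ list all $\mathbf a\in\mathrm{supp}A$ with multiplicity $A(\mathbf a)$, decreasingly in shortlex order; $T_r$ is the set of injective maps $[r]\to\mathbb N_1$ ($T_0=\{\varnothing\}$). $\varphi_0\equiv1$, $\varphi_A(\mathbf x)=n!\big(\prod_{\mathbf a\in\mathrm{supp}A}\frac1{\mathbf a!^{A(\mathbf a)}A(\mathbf a)!}\big)\sum_{\iota\in T_{s(A)}}\prod_{h=1}^{s(A)}\mathbf x_{\iota(h)}^{\mathbf a_h}$; with $\mathrm{dust}(\mathbf m)=\sum_jm_j\mathbf 1_{\mathbf e_j}$: $\psi_0\equiv1$, $\psi_A(\mathbf x)=n!\sum_{\mathbf m\in\mathbb N_0^q,\,\mathrm{dust}(\mathbf m)\le A}\frac{\mathbf x_0^{\mathbf m}}{\mathbf m!(n-|\mathbf m|)!}\varphi_{A-\mathrm{dust}(\mathbf m)}(\mathbf x)$. *)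

(* Defs.v *)
From HB Require Import structures.
From mathcomp Require Import all_boot all_order all_algebra.
From mathcomp Require Import finmap multiset.
From mathcomp Require Import all_classical all_reals all_analysis.

Set Implicit Arguments.
Unset Strict Implicit.
Unset Printing Implicit Defensive.

Import Order.TTheory GRing.Theory Num.Theory.
Import numFieldNormedType.Exports.

Local Open Scope classical_set_scope.
Local Open Scope ring_scope.

Section MultiIndices.
Variable q : nat.

Definition mindex := {ffun 'I_q -> nat}.

Implicit Types (a m : mindex) (j : 'I_q).

Definition mi0 : mindex := [ffun=> 0%N].

Definition mi1 j : mindex := [ffun i => nat_of_bool (i == j)].

(* Only used when [0 < a j], where it is the genuine difference [a - e_j]. *)
Definition mi_pred a j : mindex := [ffun i => (a i - (i == j))%N].

Definition mi_deg a : nat := (\sum_j a j)%N.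

Definition mi_fact a : nat := (\prod_j (a j)`!)%N.

Definition mpow (R : realType) (u : 'rV[R]_q) a : R := \prod_j u 0 j ^+ a j.

Definition multinom (R : realType) a : R :=
  (mi_deg a)`!%:R / (mi_fact a)%:R.

End MultiIndices.

Section Shortlex.
Context {d : Order.disp_t} {T : orderType d} {q : nat}.

(* Shortlex compares [(|s|, s_1, ..., s_q)] lexicographically; [ns] and [nt]
   stand for the l1-norms of [s] and [t]. *)
Definition shortlex_key (ns : T) (s : 'I_q -> T) : seqlexi T :=
  ns :: [seq s j | j <- enum 'I_q].

Definition shortlex_le (ns : T) (s : 'I_q -> T) (nt : T) (t : 'I_q -> T) : bool :=
  (shortlex_key ns s <= shortlex_key nt t)%O.

End Shortlex.

Definition mi_sl_le (q : nat) (a b : mindex q) : bool :=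
  shortlex_le (mi_deg a) a (mi_deg b) b.

Definition l1norm (R : realType) (q : nat) (u : 'rV[R]_q) : R :=
  \sum_j `|u 0 j|.

Definition vec_sl_le (R : realType) (q : nat) (u v : 'rV[R]_q) : bool :=
  shortlex_le (l1norm u) (fun j => u 0 j) (l1norm v) (fun j => v 0 j).

Section Partitions.
Variable q : nat.

(* A finitely supported map on the nonzero multi-indices is encoded as a multiset
   of multi-indices in which the zero index has multiplicity 0; this last
   condition is part of [cpart] and [vpart] below. *)
Definition mimset := {mset mindex q}%mset.

Implicit Types (A B : mimset) (a m : mindex q) (j : 'I_q).

Definition weight A : nat := (\sum_(a <- finsupp A) A a * mi_deg a)%N.

Definition nblocks A : nat := (\sum_(a <- finsupp A) A a)%N.

Definition cpart (n : nat) : set mimset :=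
  [set A : mimset | A (mi0 q) = 0%N /\ weight A = n].

Definition vpart (m : mindex q) : set mimset :=
  [set A : mimset | A (mi0 q) = 0%N /\
    forall j, (\sum_(a <- finsupp A) A a * a j)%N = m j].

Definition removal A a j : mimset :=
  if a == mi1 j then (A `\` [mset a])%mset
  else ((A `\` [mset a]) `+` [mset (mi_pred a j)])%mset.

Definition dust m : mimset := \big[msetD/mset0]_j msetn (m j) (mi1 j).

End Partitions.

Section PartitionStructures.
Variables (R : realType) (q : nat).

Implicit Types (A B : mimset q) (m : mindex q) (j : 'I_q).

(* A probability measure on the set [S] is given by its weights, extended by
   zero outside [S]; it is only used for the finite sets [cpart n], [vpart m]. *)
Definition is_prob_on (S : set (mimset q)) (f : mimset q -> R) : Prop :=
  [/\ forall A, 0 <= f A, forall A, ~ S A -> f A = 0 &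
      \sum_(A \in S) f A = 1].

(* The pair [(a, j)] with [B = removal A a j] is unique when it exists, so the
   choices made by [pick] here and in [down_kernel_col] are harmless. *)
Definition down_kernel (n : nat) A B : R :=
  if [pick aj : finsupp A * 'I_q |
       (0 < val aj.1 aj.2)%N && (B == removal A (val aj.1) aj.2)] is Some aj
  then (val aj.1 aj.2 * A (val aj.1))%N%:R / n%:R else 0.

Definition chromatic_partition_structure (P : nat -> mimset q -> R) : Prop :=
  (forall n, is_prob_on (@cpart q n) (P n)) /\
  (forall n B, cpart n B ->
     P n B = \sum_(A \in @cpart q n.+1) P n.+1 A * down_kernel n.+1 A B).

Definition down_kernel_col j m A B : R :=
  if [pick a : finsupp A |
       (0 < val a j)%N && (B == removal A (val a) j)] is Some a
  then (val a j * A (val a))%N%:R / (m j)%:R else 0.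

Definition pe_partition_structure (Q : mindex q -> mimset q -> R) : Prop :=
  (forall m, is_prob_on (vpart m) (Q m)) /\
  (forall m j B, (0 < m j)%N -> vpart (mi_pred m j) B ->
     Q (mi_pred m j) B = \sum_(A \in vpart m) Q m A * down_kernel_col j m A B).

Definition simplex : set 'rV[R]_q :=
  [set u : 'rV[R]_q | (forall j, 0 <= u 0 j <= 1) /\ l1norm u = 1].

Definition pe_representation (P : nat -> mimset q -> R) (p : 'rV[R]_q)
    (Q : mindex q -> mimset q -> R) : Prop :=
  [/\ simplex p, pe_partition_structure Q &
      forall n A, cpart n A ->
        P n A = \sum_(m \in [set m : mindex q | mi_deg m = n])
                  multinom R m * mpow p m * Q m A].

Definition pe_type (P : nat -> mimset q -> R) : Prop :=
  exists p Q, pe_representation P p Q.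

Definition affine_hull (S : set 'rV[R]_q) : set 'rV[R]_q :=
  [set y | exists n (c : 'I_n -> R) (s : 'I_n -> 'rV[R]_q),
     [/\ forall i, S (s i), \sum_i c i = 1 & y = \sum_i c i *: s i]].

Definition relative_interior (S : set 'rV[R]_q) : set 'rV[R]_q :=
  [set u : 'rV[R]_q | S u /\ \forall y \near u, affine_hull S y -> S y].

End PartitionStructures.

Section Kingman.
Variable R : realType.

(* Only the entries with index [i >= 1] are ordered; entry 0 carries the dust. *)
Definition nabla_set (q : nat) : set {ptws nat -> 'rV[R]_q} :=
  [set x : {ptws nat -> 'rV[R]_q} | [/\ forall i j, 0 <= x i 0 j,
               forall i, (0 < i)%N -> vec_sl_le (x i.+1) (x i) &
               (\sum_(0 <= i <oo) (l1norm (x i))%:E = 1)%E]].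

Definition nabla (q : nat) : Type := set_type (@nabla_set q).

HB.instance Definition _ q := Topological.copy (nabla q) (set_type (@nabla_set q)).

Definition nabla_pt (q : nat) : {ptws nat -> 'rV[R]_q.+1} :=
  fun i => if i == 0%N then delta_mx 0 0 else 0.

Lemma nabla_pt_in q : nabla_pt q \in @nabla_set q.+1.
Proof.
rewrite inE; split=> [i j|i i_gt0|].
- by rewrite /nabla_pt; case: eqP => _; rewrite mxE ?ler0n.
- by rewrite /nabla_pt (gtn_eqF i_gt0) /vec_sl_le /shortlex_le lexx.
- rewrite (@nneseries_split _ _ 0 1) => [|k _]; last first.
    by rewrite lee_fin; apply: sumr_ge0.
  rewrite eseries0 ?adde0 => [|k k_gt0 _]; last first.
    rewrite /nabla_pt (gtn_eqF k_gt0) /l1norm big1 => [//|j _].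
    by rewrite mxE normr0.
  rewrite big_nat1 /nabla_pt eqxx /l1norm (bigD1 ord0) //= mxE !eqxx normr1.
  rewrite big1 ?addr0 // => j /negPf j_neq0.
  by rewrite mxE j_neq0 andbF normr0.
Qed.

(* The simplex is nonempty only in positive dimension, whence [q.+1]; a base
   point is required of measurable types. *)
HB.instance Definition _ q :=
  isPointed.Build (nabla q.+1)
    (exist (fun x => x \in @nabla_set q.+1) (nabla_pt q) (nabla_pt_in q)).

End Kingman.

Notation borel T := (g_sigma_algebraType (@open T)).

Section Kernels.
Variables (R : realType) (q : nat).

Implicit Types (A : mimset q) (x : nabla R q).

Definition inj_pos (r : nat) : set {ffun 'I_r -> nat} :=
  [set iota | injective iota /\ forall h, (0 < iota h)%N].

Definition block_seq A : seq (mindex q) :=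
  sort (fun a b => mi_sl_le b a) (enum_mset A).

(* For [A = mset0] this is 1: the empty map is the only element of [inj_pos 0]. *)
Definition phi A x : \bar R :=
  (((weight A)`!%:R *
    \prod_(a <- finsupp A) ((mi_fact a ^ A a * (A a)`!)%N%:R)^-1)%:E *
  \esum_(iota in @inj_pos (nblocks A))
    (\prod_(h < nblocks A)
       mpow (val x (iota h)) (nth (mi0 q) (block_seq A) h))%:E)%E.

Definition psi A x : \bar R :=
  ((weight A)`!%:R%:E *
   \sum_(m \in [set m : mindex q | (dust m `<=` A)%mset])
     (mpow (val x 0%N) m /
        (mi_fact m * (weight A - mi_deg m)`!)%N%:R)%:E *
     phi (A `\` dust m)%mset x)%E.

Definition total_color x : 'rV[R]_q :=
  \row_j limn (fun n => \sum_(0 <= i < n) val x i 0 j).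

End Kernels.

Definition represents (R : realType) (q : nat)
    (mu : probability (borel (nabla R q.+1)) R)
    (P : nat -> mimset q.+1 -> R) : Prop :=
  forall n A, cpart n A -> (P n A)%:E = (\int[mu]_x psi A x)%E.

Definition color_dirac (R : realType) (q : nat)
    (mu : probability (borel (nabla R q.+1)) R) (p : 'rV[R]_q.+1) : Prop :=
  forall B : set (borel 'rV[R]_q.+1), measurable B ->
    pushforward mu (@total_color R q.+1 : borel (nabla R q.+1) -> borel 'rV[R]_q.+1) B =
    dirac (p : borel 'rV[R]_q.+1) B.

(* Main.v *)
Require Import Defs.
From HB Require Import structures.
From mathcomp Require Import all_boot all_order all_algebra.
From mathcomp Require Import finmap multiset.
From mathcomp Require Import all_classical all_reals all_analysis.
From mathcomp Require Import measurable_realfun.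
From mathcomp Require Import zify lra.
Import Order.TTheory GRing.Theory Num.Theory.
Import numFieldNormedType.Exports.

Set Implicit Arguments.
Unset Strict Implicit.
Unset Printing Implicit Defensive.

Local Open Scope classical_set_scope.
Local Open Scope ring_scope.

(** The law of the colours of a chromatic partition structure only enters through
its first two moments, and these are polynomials in the total colour [D].

On the side of the measure, [psi] is only needed for one and two balls.  A single
ball has colour [j] with conditional probability [D_j], and two balls both have
colour [j] with conditional probability [D_j ^ 2]: either they share a block, or
they do not, and the two cases add up to a square ([psi_mi1_total],
[psi_two_balls]).  Hence, if the colour counts of [P] are multinomial with
parameter [p], as they are for any partially exchangeable type, then [D_j] has
mean [p_j] and second moment [p_j ^ 2], so it is almost surely constant
([ae_total_color]).  Conversely, if [D = p] almost surely, then two successive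
balls have uncorrelated colours with mean [p].

On the combinatorial side, view [P] as the sequence of expectation functionals
[E_n phi = E [phi (Pi_n)]].  Removing a ball of colour [j] acts on test functions by
an operator [removal_op j] that behaves like a derivation in the blocks; these
operators commute ([removal_opC]), which is the exchangeability of the colours of
the balls [n+1, n+2, ...] given [Pi_n].  Coherence of [P] says that [(n+1) E_n] is the
sum over [j] of [E_(n+1)] composed with [removal_op j].  As the future colours are
exchangeable and there are infinitely many of them, the mean square of a sum of
[N] centred colour indicators, weighted by [phi (Pi_n)], is nonnegative for every
[N]; letting [N] grow shows that the correlation of two future colours cannot be
negative on any event.  If the total correlation vanishes, it vanishes on every
event, and then so does the covariance of the next colour with any function of
[Pi_n] ([draw_proportional]): the next ball has colour [j] with probability [p_j]
independently of [Pi_n].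

This independence makes the colour counts multinomial ([color_law_multinomial])
and turns the coherence of [P] into the coherence, colour by colour, of the
conditional laws of [Pi_n] given its colour counts ([cond_functional_removal]).
Colours of probability zero are never seen by [P]; the conditional laws are
extended to them by adding their balls as singletons ([pe_kernel]).  The
remaining claims follow from the identity
[P_|m| A = multinom m * p ^ m * Q_m A] for [A] with colour counts [m]
([pe_representation_vpart]). *)

(** * Blocks and the removal of a ball *)

Section Multisets.
Variable K : choiceType.
Implicit Types A B : {mset K}%mset.

Lemma perm_msetD A B : perm_eq (A `+` B)%mset (enum_mset A ++ enum_mset B).
Proof. by apply/allP => a _ /=; rewrite count_cat !count_mem_mset msetE2. Qed.

Lemma big_enum_msetD (V : nmodType) (F : K -> V) A B :
  \sum_(a <- (A `+` B)%mset) F a = \sum_(a <- A) F a + \sum_(a <- B) F a.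
Proof. by rewrite (perm_big _ (perm_msetD A B)) big_cat. Qed.

End Multisets.

HB.instance Definition _ (K : choiceType) :=
  Monoid.isComLaw.Build {mset K}%mset mset0 (@msetD K)
    (@msetDA K) (@msetDC K) (@mset0D K).

Section Removal.
Variable q : nat.
Implicit Types (A B : mimset q) (a b m : mindex q) (j k : 'I_q).

(** The zero index is not a block.  With this convention the removal of a ball
takes one uniform form ([removalE]), and a partition may be given by any finite
family of indices, including zero ones ([assemble] below). *)
Definition block a : mimset q := if a == mi0 q then mset0 else [mset a]%mset.

Definition color_count A j : nat := (\sum_(a <- enum_mset A) a j)%N.

Lemma mi_pred_eq0 a j : (0 < a j)%N -> (mi_pred a j == mi0 q) = (a == mi1 j).
Proof.
move=> aj; apply/eqP/eqP => [e|->]; apply/ffunP => i.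
- move/ffunP: e => /(_ i); rewrite !ffunE.
  by case: eqVneq => [->|_] /=; lia.
- by rewrite !ffunE subnn.
Qed.

Lemma removalE A a j : (0 < a j)%N ->
  removal A a j = ((A `\` [mset a]) `+` block (mi_pred a j))%mset.
Proof.
by move=> aj; rewrite /removal /block mi_pred_eq0//; case: eqP => // _; rewrite msetD0.
Qed.

Lemma neq0_gt0 a j : (0 < a j)%N -> a != mi0 q.
Proof. by apply: contraTneq => ->; rewrite ffunE. Qed.

Lemma block_mi0 a : block a (mi0 q) = 0%N.
Proof.
rewrite /block; case: eqVneq => [_|ne]; rewrite ?mset0E// msetnE.
by rewrite eq_sym (negbTE ne).
Qed.

Lemma big_block (V : nmodType) (F : mindex q -> V) a : F (mi0 q) = 0 ->
  \sum_(b <- enum_mset (block a)) F b = F a.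
Proof.
move=> F0; rewrite /block; case: eqVneq => [->|_].
  by rewrite enum_mset0 big_nil.
by rewrite enum_msetn big_seq1.
Qed.

Lemma color_countD A B j :
  color_count (A `+` B)%mset j = (color_count A j + color_count B j)%N.
Proof. exact: (@big_enum_msetD _ nat). Qed.

Lemma color_count0 j : color_count mset0 j = 0%N.
Proof. by rewrite /color_count enum_mset0 big_nil. Qed.

Lemma color_countn n a j : color_count (msetn n a) j = (n * a j)%N.
Proof.
by rewrite /color_count enum_msetn big_nseq iter_addn_0 mulnC.
Qed.

Lemma color_count_block a j : color_count (block a) j = a j.
Proof. by apply: (@big_block nat (fun a => a j)); rewrite ffunE. Qed.

Lemma color_count_ge A a j : a \in A -> (a j <= color_count A j)%N.
Proof.
by move=> aA; rewrite -(msetB1K aA) color_countD color_countn mul1n leq_addr.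
Qed.

Lemma color_count_removal A a j k : a \in A -> (0 < a j)%N ->
  color_count (removal A a j) k = (color_count A k - (k == j))%N.
Proof.
move=> aA aj; rewrite removalE// color_countD color_count_block.
rewrite -[in RHS](msetB1K aA) color_countD color_countn mul1n ffunE.
case: eqVneq => [->|_]; lia.
Qed.

Lemma color_count_pos A j : (0 < color_count A j)%N ->
  exists2 a, a \in A & (0 < a j)%N.
Proof.
rewrite lt0n => h; have : ~~ all (fun a : mindex q => a j == 0%N) (enum_mset A).
  apply: contra h => /allP h; apply/eqP; rewrite /color_count big_seq big1//.
  by move=> a /h/eqP.
by move=> /allPn[a aA]; rewrite -lt0n => ?; exists a.
Qed.

Lemma vpartE m A :
  vpart m A <-> A (mi0 q) = 0%N /\ forall j, color_count A j = m j.
Proof.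
by rewrite /vpart /=; split=> -[A0 h]; split=> // j; rewrite -h /color_count sum_mset.
Qed.

Lemma weightE A : weight A = (\sum_j color_count A j)%N.
Proof. by rewrite /weight -sum_mset exchange_big. Qed.

Lemma vpart_cpart m A : vpart m A -> cpart (mi_deg m) A.
Proof.
move=> /vpartE[A0 h]; split=> //; rewrite weightE.
by apply: eq_bigr => j _; exact: h.
Qed.

Lemma cpart_vpart n A : cpart n A ->
  exists2 m : mindex q, mi_deg m = n & vpart m A.
Proof.
move=> [A0 wA]; exists [ffun j => color_count A j].
  by rewrite -wA weightE; apply: eq_bigr => j _; rewrite ffunE.
by apply/vpartE; split=> // j; rewrite ffunE.
Qed.

Lemma vpart_inj m m' A : vpart m A -> vpart m' A -> m = m'.
Proof.
by move=> /vpartE[_ h] /vpartE[_ h']; apply/ffunP => j; rewrite -h -h'.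
Qed.

Lemma mi_deg_pred m j : (0 < m j)%N -> mi_deg (mi_pred m j) = (mi_deg m).-1.
Proof.
move=> mj; rewrite /mi_deg (bigD1 j)//= [in RHS](bigD1 j)//= ffunE eqxx.
rewrite (eq_bigr (fun i => m i)); first by rewrite -subn1 addnBAC.
by move=> i /negbTE ij; rewrite ffunE ij subn0.
Qed.

Lemma mi_deg_gt0 m j : (0 < m j)%N -> (0 < mi_deg m)%N.
Proof. by move=> mj; rewrite /mi_deg (bigD1 j)//= addn_gt0 mj. Qed.

Lemma mi_deg_eq0 m : mi_deg m = 0%N -> m = mi0 q.
Proof.
move=> m0; apply/ffunP => j; rewrite ffunE; apply/eqP; rewrite -leqn0 -ltnS ltnNge.
by apply/negP => /mi_deg_gt0; rewrite m0.
Qed.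

Lemma removal_mi0 A a j : A (mi0 q) = 0%N -> (0 < a j)%N ->
  removal A a j (mi0 q) = 0%N.
Proof. by move=> A0 aj; rewrite removalE// !msetE2 A0 block_mi0. Qed.

Lemma vpart_removal m A a j : A (mi0 q) = 0%N -> a \in A -> (0 < a j)%N ->
  (0 < m j)%N ->
  vpart (mi_pred m j) (removal A a j) <-> vpart m A.
Proof.
move=> A0 aA aj mj; split=> /vpartE[_ h]; apply/vpartE; split=> //; last 2 first.
- exact: removal_mi0.
- by move=> k; rewrite color_count_removal// ffunE h.
- move=> k; have := h k; rewrite color_count_removal// ffunE.
  have := color_count_ge j aA.
  by case: eqVneq => [->|_] /=; lia.
Qed.

Lemma cpart_removal n A a j : cpart n.+1 A -> a \in A -> (0 < a j)%N ->
  cpart n (removal A a j).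
Proof.
move=> /cpart_vpart[m mn /[dup] [] [A0 _] mA] aA aj.
have mj : (0 < m j)%N.
  by move/vpartE : mA => [_ <-]; rewrite (leq_trans aj)// color_count_ge.
suff -> : n = mi_deg (mi_pred m j) by apply: vpart_cpart; apply/vpart_removal.
by rewrite mi_deg_pred// mn.
Qed.

(** The colour counts of the result reveal the colour of the removed ball; the
block is then recovered because its multiplicity drops, as a block never equals
what remains of it. *)
Lemma removal_inj A a b j k : a \in A -> b \in A -> (0 < a j)%N -> (0 < b k)%N ->
  removal A a j = removal A b k -> a = b /\ j = k.
Proof.
move=> aA bA aj bk e.
have jk : j = k.
  apply/eqP; apply: contraT => jk.
  have := congr1 (fun A => color_count A j) e.
  rewrite !color_count_removal// eqxx (negbTE jk) subn0 subn1.
  have := color_count_ge j aA; move: (color_count A j) => c.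
  by move: aj; move: (a j) => d; clear; lia.
subst k; split=> //; apply/eqP; apply: contraT => ab.
have := congr1 (fun B : mimset q => B a) e.
rewrite !removalE// !msetE2 !msetnE eqxx (negbTE ab).
have -> : block (mi_pred a j) a = 0%N.
  rewrite /block; case: ifP => _; rewrite ?mset0E// msetnE; case: eqP => // /ffunP/(_ j).
  by rewrite ffunE eqxx subn1; move: aj; move: (a j) => d; clear; lia.
by move: aA; rewrite in_mset; move: (A a) => d; clear; lia.
Qed.

End Removal.

(** * Removal as a family of commuting operators *)

Section Derivation.
Variables (R : realType) (q : nat).
Implicit Types (A B : mimset q) (a b m : mindex q) (i j k : 'I_q).
Implicit Types (phi : mimset q -> R).

(** Up to the factor [n], the expectation of [phi] after a uniformly chosen ball
of [A] has been removed, restricted to the event that its colour is [j]. *)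
Definition removal_op j phi A : R :=
  \sum_(a <- enum_mset A) (a j)%:R * phi (removal A a j).

(** Indexing the blocks by positions and keeping the exhausted ones as zero
indices turns the removal of a ball into the decrease of one entry of a fixed
array, so that removals at distinct positions visibly commute. *)
Definition assemble r (t : {ffun 'I_r -> mindex q}) : mimset q :=
  \big[msetD/mset0]_(h < r) block (t h).

Definition lower r (t : {ffun 'I_r -> mindex q}) (h : 'I_r) j :
    {ffun 'I_r -> mindex q} :=
  [ffun k => if k == h then mi_pred (t h) j else t k].

Lemma big_assemble (V : nmodType) (F : mindex q -> V) r
    (t : {ffun 'I_r -> mindex q}) : F (mi0 q) = 0 ->
  \sum_(a <- enum_mset (assemble t)) F a = \sum_h F (t h).
Proof.
move=> F0; rewrite /assemble.
rewrite (big_morph (fun A : mimset q => \sum_(a <- enum_mset A) F a)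
  (big_enum_msetD F) (_ : _ = 0)); last by rewrite enum_mset0 big_nil.
by apply: eq_bigr => h _; exact: big_block.
Qed.

Lemma assemble_mi0 r (t : {ffun 'I_r -> mindex q}) : assemble t (mi0 q) = 0%N.
Proof.
rewrite /assemble; elim/big_ind: _ => [|A B A0 B0|h _]; rewrite ?mset0E ?block_mi0//.
by rewrite !msetE2 A0 B0.
Qed.

Lemma removal_assemble r (t : {ffun 'I_r -> mindex q}) h j : (0 < t h j)%N ->
  removal (assemble t) (t h) j = assemble (lower t h j).
Proof.
move=> thj; rewrite removalE// /assemble (bigD1 h)//= [in RHS](bigD1 h)//=.
rewrite {1}/block (negbTE (neq0_gt0 thj)) msetD1K msetDC ffunE eqxx; congr msetD.
by apply: eq_bigr => k /negbTE kh; rewrite ffunE kh.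
Qed.

Lemma removal_op_assemble j phi r (t : {ffun 'I_r -> mindex q}) :
  removal_op j phi (assemble t) = \sum_h (t h j)%:R * phi (assemble (lower t h j)).
Proof.
rewrite /removal_op (big_assemble _ (F := fun a => (a j)%:R * phi (removal (assemble t) a j))).
  apply: eq_bigr => h _; have [->|] := posnP (t h j); first by rewrite !mul0r.
  by move=> /removal_assemble ->.
by rewrite ffunE mul0r.
Qed.

Lemma assembleP A r : A (mi0 q) = 0%N -> (size (enum_mset A) <= r)%N ->
  A = assemble [ffun h : 'I_r => nth (mi0 q) (enum_mset A) h].
Proof.
move=> A0 sA; apply/msetP => b.
have [->|b0] := eqVneq b (mi0 q); first by rewrite A0 assemble_mi0.
have E (B : mimset q) : B b = \sum_(a <- enum_mset B) (a == b : nat).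
  by rewrite -count_mem_mset -sum1_count big_mkcond.
rewrite [LHS]E [RHS]E big_assemble; last by rewrite eq_sym (negbTE b0).
rewrite (big_nth (mi0 q)) big_mkord.
rewrite (big_ord_widen r (fun h => (nth (mi0 q) (enum_mset A) h == b : nat)) sA).
rewrite big_mkcond; apply: eq_bigr => h _; rewrite ffunE; case: ltnP => // sh.
by rewrite nth_default// eq_sym (negbTE b0).
Qed.

(** In array form both sides are sums over two positions.  Distinct positions do
not interact; at equal positions the weight is [a_i * a_j] on both sides since
the two colours differ. *)
Lemma removal_opC i j phi A : A (mi0 q) = 0%N ->
  removal_op i (removal_op j phi) A = removal_op j (removal_op i phi) A.
Proof.
have [<-//|ij A0] := eqVneq i j.
rewrite (assembleP A0 (leqnn _)); move: [ffun _ => _] => t; set r := size _ in t *.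
rewrite !removal_op_assemble.
under eq_bigr do rewrite removal_op_assemble mulr_sumr.
under [RHS]eq_bigr do rewrite removal_op_assemble mulr_sumr.
rewrite exchange_big/=; apply: eq_bigr => h _; apply: eq_bigr => k _.
have -> : lower (lower t k i) h j = lower (lower t h j) k i.
  apply/ffunP => l; apply/ffunP => p; rewrite !ffunE.
  have [->|lh] := eqVneq l h; have [hk|hk] := eqVneq _ k; rewrite ?ffunE //.
    by rewrite hk subnAC.
  by rewrite -hk (negbTE lh).
rewrite !mulrA; congr (_ * _).
rewrite !ffunE; have [->|hk] := eqVneq h k.
  by rewrite !ffunE (eq_sym j i) (negbTE ij) !subn0 mulrC.
by rewrite mulrC.
Qed.

Lemma removal_op_ge0 j phi A : (forall B, 0 <= phi B) -> 0 <= removal_op j phi A.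
Proof. by move=> h; apply: sumr_ge0 => a _; rewrite mulr_ge0. Qed.

Lemma eq_removal_op n j phi psi A : cpart n.+1 A ->
  (forall B, cpart n B -> phi B = psi B) ->
  removal_op j phi A = removal_op j psi A.
Proof.
move=> nA e; apply: eq_big_seq => a aA.
have [->|aj] := posnP (a j); first by rewrite !mul0r.
by rewrite e//; exact: cpart_removal.
Qed.

Lemma removal_opD j phi psi A :
  removal_op j (fun B => phi B + psi B) A = removal_op j phi A + removal_op j psi A.
Proof. by rewrite -big_split; apply: eq_bigr => a _; rewrite mulrDr. Qed.

Lemma removal_opZ j c phi A :
  removal_op j (fun B => c * phi B) A = c * removal_op j phi A.
Proof. by rewrite mulr_sumr; apply: eq_bigr => a _; rewrite mulrCA. Qed.

Lemma removal_op1 j A : removal_op j (fun=> 1) A = (color_count A j)%:R.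
Proof.
by rewrite /color_count natr_sum; apply: eq_bigr => a _; rewrite mulr1.
Qed.

(** Localizing at given colour counts commutes with removal, because a removal
changes these counts in a deterministic way. *)
Lemma removal_op_vpart j m phi A : A (mi0 q) = 0%N -> (0 < m j)%N ->
  removal_op j (fun B => (`[< vpart (mi_pred m j) B >])%:R * phi B) A =
  (`[< vpart m A >])%:R * removal_op j phi A.
Proof.
move=> A0 mj; rewrite mulr_sumr; apply: eq_big_seq => a aA.
have [->|aj] := posnP (a j); first by rewrite !mul0r mulr0.
by rewrite mulrCA (asbool_equiv_eq (vpart_removal A0 aA aj mj)).
Qed.

(** A partition of [n] has at most [n] blocks, with entries at most [n], so it is
assembled from an array with [n] bounded entries. *)
Lemma finite_cpart n : finite_set (@cpart q n).
Proof.
pose F (t : {ffun 'I_n -> {ffun 'I_q -> 'I_n.+1}}) : mimset q :=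
  assemble [ffun h => [ffun j => nat_of_ord (t h j)]].
apply: (@sub_finite_set _ _ (F @` [set: {ffun 'I_n -> {ffun 'I_q -> 'I_n.+1}}])); last first.
  exact/finite_image/finite_finset.
move=> A [A0 wA].
have lej a : a \in A -> forall j, (a j <= n)%N.
  move=> aA j; rewrite (leq_trans (color_count_ge j aA))// -wA weightE.
  by rewrite (bigD1 j)//= leq_addr.
have sA : (size (enum_mset A) <= n)%N.
  rewrite -wA /weight -sum_mset -sum1_size big_seq_cond [leqRHS]big_seq_cond.
  apply: leq_sum => a /andP[aA _]; rewrite lt0n; apply/eqP => /mi_deg_eq0 a0.
  by move: aA; rewrite a0 in_mset A0.
exists [ffun h : 'I_n => [ffun j => inord (nth (mi0 q) (enum_mset A) h j)]] => //.
rewrite {2}(assembleP A0 sA) /F; congr assemble; apply/ffunP => h; rewrite !ffunE.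
apply/ffunP => j; rewrite !ffunE inordK// ltnS.
have [hs|hs] := ltnP h (size (enum_mset A)); first by apply: lej; rewrite mem_nth.
by rewrite nth_default// ffunE.
Qed.

End Derivation.

(** * Coherent functionals and uncorrelated draws *)

Section QuadraticFacts.
Variable R : realType.

Lemma quad_growth_ge0 (x y : R) :
  (forall N, 0 <= N%:R ^+ 2 * x + N%:R * y) -> 0 <= x.
Proof.
move=> h; rewrite leNgt; apply/negP => x0.
pose N := Num.bound (`|y| / - x).
have y_ge0 : 0 <= `|y| / - x by rewrite divr_ge0// oppr_ge0 ltW.
have := Num.Theory.archi_boundP y_ge0; rewrite -/N.
rewrite ltr_pdivrMr ?oppr_gt0// => yN.
have N0 : 0 < (N%:R : R).
  by have := le_lt_trans (normr_ge0 y) yN; rewrite pmulr_lgt0// oppr_gt0.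
have := h N; rewrite expr2 -mulrA -mulrDr pmulr_rge0// => {}h.
have := ler_norm y; lra.
Qed.

Lemma linear_term_eq0 (l d : R) : 0 <= l ->
  (forall t, 0 <= t ^+ 2 * l + 2 * t * d) -> d = 0.
Proof.
move=> l0 h; apply/eqP; apply: contraT => d0.
have l1 : 0 < l + 1 by rewrite ltr_wpDl.
(* Up to the shift [l + 1], which covers [l = 0], the witness [t = - d * v] is the
   minimizer of the quadratic polynomial. *)
pose v := (l + 1)^-1.
have v0 : 0 < v by rewrite invr_gt0.
have vl : v * l = 1 - v.
  have : v * (l + 1) = 1 by rewrite mulVf// gt_eqF.
  by lra.
have := h (- d * v).
have -> : (- d * v) ^+ 2 * l + 2 * (- d * v) * d = d ^+ 2 * v * (v * l - 2) by lra.
rewrite vl leNgt nmulr_llt0; last by lra.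
by rewrite pmulr_lgt0// exprn_even_gt0//= d0.
Qed.

End QuadraticFacts.

Section Coherent.
Variables (R : realType) (q : nat).
Implicit Types (phi psi : mimset q -> R) (i j : 'I_q).
Implicit Types (L : nat -> (mimset q -> R) -> R).

(** [L n phi] stands for the expectation of [phi (Pi_n)] on a fixed event that
concerns only the colours of later balls.  [coh_down] averages over the colour of
ball [n+1], and [coh_ext] says that only partitions of [n] matter. *)
Record coherent L : Prop := Coherent {
  coh_ext : forall n phi psi, (forall A, cpart n A -> phi A = psi A) ->
    L n phi = L n psi;
  coh_add : forall n phi psi, L n (fun A => phi A + psi A) = L n phi + L n psi;
  coh_scale : forall n c phi, L n (fun A => c * phi A) = c * L n phi;
  coh_down : forall n phi,
    n.+1%:R * L n phi = \sum_i L n.+1 (removal_op i phi) }.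

(** The expectation on the event that the next ball has colour [j]. *)
Definition draw j L : nat -> (mimset q -> R) -> R :=
  fun n phi => n.+1%:R^-1 * L n.+1 (removal_op j phi).

Lemma drawE j L n phi : n.+1%:R * draw j L n phi = L n.+1 (removal_op j phi).
Proof. by rewrite mulrA mulfV ?mul1r// pnatr_eq0. Qed.

(** This is the exchangeability of the colours of two successive balls, that is,
the commutation of the removal operators. *)
Lemma coherent_draw j L : coherent L -> coherent (draw j L).
Proof.
move=> [ext add scale down]; split.
- move=> n phi psi e; congr (_ * _); apply: ext => A nA.
  exact: eq_removal_op nA e.
- move=> n phi psi; rewrite -mulrDr -add; congr (_ * _); apply: ext => A _.
  exact: removal_opD.
- move=> n c phi; rewrite mulrCA -scale; congr (_ * _); apply: ext => A _.
  exact: removal_opZ.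
- move=> n phi; rewrite drawE; apply: (mulfI (_ : n.+2%:R != 0)).
    by rewrite pnatr_eq0.
  rewrite down mulr_sumr; apply: eq_bigr => i _; rewrite drawE.
  by apply: ext => A [A0 _]; exact: removal_opC.
Qed.

Lemma coherent_total L : coherent L -> forall n, L n (fun=> 1) = L 0%N (fun=> 1).
Proof.
move=> [ext add scale down]; elim=> // n <-.
apply: (mulfI (_ : n.+1%:R != 0)); rewrite ?pnatr_eq0//.
have sumE (F : 'I_q -> mimset q -> R) (s : seq 'I_q) :
    L n.+1 (fun A => \sum_(i <- s) F i A) = \sum_(i <- s) L n.+1 (F i).
  elim: s => [|i s IHs].
    rewrite big_nil; transitivity (L n.+1 (fun=> 0 * 1)).
      by apply: ext => A _; rewrite big_nil mul0r.
    by rewrite scale mul0r.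
  by rewrite big_cons -IHs -add; apply: ext => A _; rewrite big_cons.
rewrite down -sumE -scale; apply: ext => A [_ wA].
rewrite mulr1 -wA weightE natr_sum; apply: eq_bigr => i _.
by rewrite removal_op1.
Qed.

(** The functionals [V] and [W] record that the next ball, respectively the next
two balls, have colour [j]; [c] is the candidate for the limiting frequency of
this colour. *)
Section MeanErgodic.
Variables (L : nat -> (mimset q -> R) -> R) (j : 'I_q) (c : R).
Hypothesis coh_L : coherent L.
Hypothesis L_ge0 : forall n phi, (forall A, 0 <= phi A) -> 0 <= L n phi.

Let V := draw j L.
Let W := draw j V.

(** With [Y_t] the indicator that the [t]-th ball after the [n]-th one has colour
[j], this is the expectation of [(Y_1 - c) * (Y_2 - c) * phi (Pi_n)]. *)
Let defect n phi := W n phi - 2 * c * V n phi + c ^+ 2 * L n phi.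

(** The expectation of [(s + sum_(t <= N) (Y_t - c)) ^ 2 * phi (Pi_n)], expanded
by exchangeability.  Conditioning on the first colour relates it to the same
expression for [N - 1] balls after the [n+1]-st one ([square_step]), which yields
its nonnegativity without reference to any probability space. *)
Let square N n s phi :=
  s ^+ 2 * L n phi + 2 * s * N%:R * (V n phi - c * L n phi)
  + N%:R * ((1 - 2 * c) * V n phi + c ^+ 2 * L n phi)
  + N%:R * (N%:R - 1) * defect n phi.

Lemma square_step N n s phi : n.+1%:R * square N.+1 n s phi =
  \sum_i square N n.+1 (s + (i == j)%:R - c) (removal_op i phi).
Proof.
have coh_V : coherent V := coherent_draw j coh_L.
have coh_W : coherent W := coherent_draw j coh_V.
have pick (F : 'I_q -> R) : \sum_i (i == j)%:R * F i = F j.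
  rewrite (bigD1 j)//= eqxx mul1r big1 ?addr0// => i /negbTE ->.
  by rewrite mul0r.
have sep i : square N n.+1 (s + (i == j)%:R - c) (removal_op i phi) =
  ((s - c) ^+ 2 - 2 * (s - c) * N%:R * c + N%:R ^+ 2 * c ^+ 2)
    * L n.+1 (removal_op i phi)
  + (2 * (s - c) * N%:R + N%:R * (1 - 2 * c * N%:R))
    * V n.+1 (removal_op i phi)
  + N%:R * (N%:R - 1) * W n.+1 (removal_op i phi)
  + (i == j)%:R *
  ((1 + 2 * (s - c) - 2 * N%:R * c) * L n.+1 (removal_op i phi)
   + 2 * N%:R * V n.+1 (removal_op i phi)).
  by rewrite /square /defect; case: eqP => _ /=; lra.
under [RHS]eq_bigr do rewrite sep.
rewrite !big_split/= pick.
rewrite -(mulr_sumr _ _ (fun i => L n.+1 (removal_op i phi))).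
rewrite -(mulr_sumr _ _ (fun i => V n.+1 (removal_op i phi))).
rewrite -(mulr_sumr _ _ (fun i => W n.+1 (removal_op i phi))).
rewrite -(coh_down coh_L) -(coh_down coh_V) -(coh_down coh_W).
rewrite -(drawE j L) -(drawE j V) -/V -/W.
by rewrite /square /defect -(natr1 N); lra.
Qed.

Lemma square_ge0 N n s phi : (forall A, 0 <= phi A) -> 0 <= square N n s phi.
Proof.
elim: N n s phi => [|N IHN] n s phi phi0.
  by rewrite /square !(mul0r, mulr0, addr0) mulr_ge0 ?sqr_ge0 ?L_ge0.
rewrite -(@pmulr_rge0 _ n.+1%:R) ?ltr0n// square_step sumr_ge0// => i _.
by apply: IHN => A; exact: removal_op_ge0.
Qed.

(** Rescaling [s] by [N], only the terms of order [N ^ 2] survive in the limit. *)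
Lemma quad_ge0 n phi : (forall A, 0 <= phi A) -> forall t,
  0 <= t ^+ 2 * L n phi + 2 * t * (V n phi - c * L n phi) + defect n phi.
Proof.
move=> phi0 t; apply: (@quad_growth_ge0 _ _
  ((1 - 2 * c) * V n phi + c ^+ 2 * L n phi - defect n phi)) => N.
by have := square_ge0 N n (t * N%:R) phi0; rewrite /square; lra.
Qed.

(** The defect is a nonnegative functional whose total mass does not depend on
[n].  If this mass is zero, the quadratic polynomial of [quad_ge0] has no constant
term, so its linear term must vanish as well. *)
Lemma draw_proportional n phi : defect 0 (fun=> 1) = 0 ->
  (forall A, 0 <= phi A <= 1) -> V n phi = c * L n phi.
Proof.
have coh_V : coherent V := coherent_draw j coh_L.
have coh_W : coherent W := coherent_draw j coh_V.
move=> d0 phi01.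
have phi0 A : 0 <= phi A by case/andP: (phi01 A).
have cphi0 A : 0 <= 1 + (-1) * phi A.
  by case/andP: (phi01 A) => _ h; lra.
have dge0 psi : (forall A, 0 <= psi A) -> 0 <= defect n psi.
  by move=> /(quad_ge0 n)/(_ 0); rewrite expr0n/= !(mul0r, mulr0, add0r).
have dphi : defect n phi = 0.
  apply/eqP; rewrite eq_le dge0// andbT.
  have := dge0 _ cphi0; rewrite /defect !coh_add// !coh_scale// !coherent_total//.
  by move: d0; rewrite /defect; lra.
apply/eqP; rewrite -subr_eq0; apply/eqP.
apply: (@linear_term_eq0 _ (L n phi)); first exact: L_ge0.
by move=> t; have := quad_ge0 n phi0 t; rewrite dphi addr0.
Qed.

End MeanErgodic.

End Coherent.

(** * The transition kernels as removal operators *)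

Section Kernels.
Variables (R : realType) (q : nat).
Implicit Types (A B : mimset q) (a b m : mindex q) (i j k : 'I_q).
Implicit Types (f phi : mimset q -> R) (S : set (mimset q)).

Definition dirac_at B A : R := (A == B)%:R.

Lemma sum_mset_single (F : mindex q -> R) A a :
  (forall b, b \in A -> b != a -> F b = 0) ->
  \sum_(b <- enum_mset A) F b = (A a)%:R * F a.
Proof.
move=> F0; transitivity (\sum_(b <- enum_mset A) if b == a then F a else 0).
  by apply: eq_big_seq => b bA; case: eqVneq => [->//|]; exact: F0.
by rewrite -big_mkcond big_const_seq iter_addr_0 count_mem_mset mulr_natl.
Qed.

Lemma removal_op_dirac_removal A a j k : a \in A -> (0 < a j)%N ->
  removal_op k (dirac_at (removal A a j)) A =
  if k == j then (a j * A a)%N%:R else 0.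
Proof.
move=> aA aj; rewrite /removal_op /dirac_at.
have inj b : b \in A -> (0 < b k)%N -> removal A b k = removal A a j -> b = a /\ k = j.
  by move=> bA bk; exact: removal_inj.
case: eqVneq => [kj|kj].
  subst k; rewrite (sum_mset_single (a := a)); first by rewrite eqxx mulr1 mulnC natrM.
  move=> b bA ba; have [->|bj] := posnP (b j); first by rewrite mul0r.
  case: eqP => [e|_]; last by rewrite mulr0.
  by case: (inj _ bA bj e) => e'; rewrite e' eqxx in ba.
rewrite big_seq big1// => b bA; have [->|bk] := posnP (b k); first by rewrite mul0r.
case: eqP => [e|_]; last by rewrite mulr0.
by case: (inj _ bA bk e) => _ e'; rewrite e' eqxx in kj.
Qed.

Lemma removal_op_dirac_eq0 A B j :
  (forall a, a \in A -> (0 < a j)%N -> B != removal A a j) ->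
  removal_op j (dirac_at B) A = 0.
Proof.
move=> none; rewrite /removal_op big_seq big1// => a aA.
have [->|aj] := posnP (a j); first by rewrite mul0r.
by rewrite /dirac_at eq_sym (negbTE (none _ aA aj)) mulr0.
Qed.

Lemma down_kernelE n A B :
  down_kernel R n A B = (\sum_j removal_op j (dirac_at B) A) / n%:R.
Proof.
rewrite /down_kernel; case: pickP => [[a j] /=/andP[aj /eqP ->]|none].
  have aA : val a \in A by rewrite -msuppE; exact: valP.
  rewrite (bigD1 j)//= big1 => [|k /negbTE kj].
    by rewrite removal_op_dirac_removal// eqxx addr0.
  by rewrite removal_op_dirac_removal// kj.
rewrite big1 ?mul0r// => j _; apply: removal_op_dirac_eq0 => a aA aj.
rewrite -msuppE in aA.
by have := none ([` aA]%fset, j); rewrite /= aj => /negbT.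
Qed.

Lemma down_kernel_colE j m A B :
  down_kernel_col R j m A B = removal_op j (dirac_at B) A / (m j)%:R.
Proof.
rewrite /down_kernel_col; case: pickP => [a /=/andP[aj /eqP ->]|none].
  by rewrite removal_op_dirac_removal ?eqxx// -msuppE; exact: valP.
rewrite removal_op_dirac_eq0 ?mul0r// => a aA aj; rewrite -msuppE in aA.
by have := none ([` aA]%fset); rewrite /= aj => /negbT.
Qed.

Definition expect S f phi : R := \sum_(A <- fset_set S) f A * phi A.

Lemma mem_fset_set_seq S A : finite_set S -> A \in fset_set S <-> S A.
Proof. by move=> fS; rewrite in_fset_set// inE. Qed.

Lemma eq_expect S f f' phi phi' : finite_set S ->
  (forall A, S A -> f A * phi A = f' A * phi' A) ->
  expect S f phi = expect S f' phi'.
Proof.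
by move=> fS e; apply: eq_big_seq => A /(mem_fset_set_seq _ fS); exact: e.
Qed.

Lemma expectE S f phi : finite_set S ->
  expect S f phi = \sum_(A \in S) f A * phi A.
Proof. by move=> fS; rewrite fsbig_finite. Qed.

Lemma expect_dirac_at S f B : finite_set S -> S B -> expect S f (dirac_at B) = f B.
Proof.
move=> fS SB; rewrite expectE// (fsbigD1 B)//= /dirac_at eqxx mulr1 fsbig1 ?addr0//.
by move=> A [_ /= /eqP/negbTE ->]; rewrite mulr0.
Qed.

Lemma expect_subset S S' f phi : finite_set S -> S' `<=` S ->
  expect S' f phi = expect S f (fun A => (`[< S' A >])%:R * phi A).
Proof.
move=> fS sub; rewrite !expectE//; last exact: sub_finite_set fS.
rewrite -(fsbig_widen S' S)//=; last first.
  by move=> A [_ /= /asboolPn/negbTE ->]; rewrite mul0r mulr0.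
by apply: eq_fsbigr => A; rewrite inE => S'A; rewrite asboolT ?mul1r.
Qed.

Lemma finite_vpart m : finite_set (@vpart q m).
Proof. by apply: sub_finite_set (finite_cpart q (mi_deg m)); exact: vpart_cpart. Qed.

(** Kernels are only given by their values at single partitions; this recovers
the operator on all test functions by linearity. *)
Lemma sum_removal_op_dirac_at S phi j A : finite_set S ->
  (forall a, a \in A -> (0 < a j)%N -> S (removal A a j)) ->
  \sum_(B <- fset_set S) phi B * removal_op j (dirac_at B) A = removal_op j phi A.
Proof.
move=> fS h; under eq_bigr do rewrite mulr_sumr.
rewrite exchange_big; apply: eq_big_seq => a aA.
have [->|aj] := posnP (a j).
  by rewrite mul0r big1// => B _; rewrite mul0r mulr0.
rewrite -[phi _](@expect_dirac_at S phi (removal A a j))//; last exact: h.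
rewrite mulr_sumr; apply: eq_bigr => B _; rewrite mulrCA /dirac_at.
by rewrite (eq_sym B).
Qed.

Definition part_functional (P : nat -> mimset q -> R) n phi :=
  expect (@cpart q n) (P n) phi.

Lemma coherent_part_functional P : chromatic_partition_structure P ->
  coherent (part_functional P).
Proof.
move=> [Pprob Pdown]; split.
- move=> n phi psi e; apply: eq_expect; first exact: finite_cpart.
  by move=> A /e ->.
- by move=> n phi psi; rewrite -big_split; apply: eq_bigr => A _; rewrite mulrDr.
- by move=> n c phi; rewrite mulr_sumr; apply: eq_bigr => A _; rewrite mulrCA.
- move=> n phi.
  have fc := finite_cpart q.
  transitivity (\sum_(B <- fset_set (@cpart q n)) \sum_(A <- fset_set (@cpart q n.+1))
     P n.+1 A * \sum_i (phi B * removal_op i (dirac_at B) A)).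
    rewrite mulr_sumr; apply: eq_big_seq => B /(mem_fset_set_seq _ (fc n)) nB.
    rewrite Pdown// fsbig_finite// mulr_suml mulr_sumr; apply: eq_bigr => A _.
    rewrite down_kernelE -mulr_sumr; move: (\sum_i _) => s.
    have := mulfV (_ : n.+1%:R != 0 :> R); rewrite pnatr_eq0 => /(_ isT).
    set v := _^-1; move: (n.+1%:R : R) => k kv.
    by transitivity (k * v * (P n.+1 A * (phi B * s))); [lra|rewrite kv mul1r].
  under [RHS]eq_bigr do rewrite /part_functional /expect.
  rewrite exchange_big [RHS]exchange_big/=.
  apply: eq_big_seq => A /(mem_fset_set_seq _ (fc n.+1)) nA.
  rewrite -!mulr_sumr exchange_big/=; congr (_ * _); apply: eq_bigr => i _.
  rewrite sum_removal_op_dirac_at// => a aA ai; exact: cpart_removal.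
Qed.

End Kernels.

(** * Multi-indices and dust *)

Section MultiIndexFacts.
Variables (R : realType) (q : nat).
Implicit Types (m : mindex q) (j k : 'I_q) (p : 'rV[R]_q).

Definition mi_twice j : mindex q := [ffun i => (2 * mi1 j i)%N].

Lemma mi_pred_mi1 j : mi_pred (mi1 j) j = mi0 q.
Proof. by apply/ffunP => i; rewrite !ffunE subnn. Qed.

Lemma mi_deg0 : mi_deg (mi0 q) = 0%N.
Proof. by rewrite /mi_deg big1// => j _; rewrite ffunE. Qed.

Lemma mi_deg1 j : mi_deg (mi1 j) = 1%N.
Proof.
rewrite /mi_deg (bigD1 j)//= ffunE eqxx big1// => i /negbTE ij.
by rewrite ffunE ij.
Qed.

Lemma mi1_inj : injective (@mi1 q).
Proof.
move=> i j /ffunP/(_ i); rewrite !ffunE eqxx.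
by case: eqVneq.
Qed.

Lemma multinom_pred m j : (0 < m j)%N ->
  multinom R m * (m j)%:R = (mi_deg m)%:R * multinom R (mi_pred m j).
Proof.
move=> mj; rewrite /multinom mi_deg_pred//.
have -> : (mi_fact m = m j * mi_fact (mi_pred m j))%N.
  rewrite /mi_fact (bigD1 j)//= [in RHS](bigD1 j)//= ffunE eqxx subn1 mulnA.
  rewrite -[in LHS](prednK mj) factS prednK//; congr (_ * _)%N.
  by apply: eq_bigr => i /negbTE ij; rewrite ffunE ij subn0.
rewrite -[in LHS](prednK (mi_deg_gt0 mj)) factS prednK ?(mi_deg_gt0 mj)//.
rewrite !natrM invfM; have := mulVf (_ : (m j)%:R != 0 :> R).
rewrite pnatr_eq0 -lt0n mj => /(_ isT); set x := (m j)%:R; set v := x^-1 => xv.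
by transitivity ((mi_deg m)%:R * ((mi_deg m).-1)`!%:R *
   (mi_fact (mi_pred m j))%:R^-1 * (v * x)); [lra|rewrite xv; lra].
Qed.

Lemma mpow_pred p m j : (0 < m j)%N ->
  mpow p m = p 0 j * mpow p (mi_pred m j).
Proof.
move=> mj; rewrite /mpow (bigD1 j)//= [in RHS](bigD1 j)//= ffunE eqxx subn1 mulrA.
rewrite -exprS prednK//; congr (_ * _).
by apply: eq_bigr => i /negbTE ij; rewrite ffunE ij subn0.
Qed.

Lemma multinom0 : multinom R (mi0 q) = 1.
Proof.
rewrite /multinom mi_deg0 /mi_fact big1 ?divr1// => j _.
by rewrite ffunE.
Qed.

Lemma mpow0 p : mpow p (mi0 q) = 1.
Proof. by rewrite /mpow big1// => j _; rewrite ffunE expr0. Qed.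

Lemma multinom_gt0 m : 0 < multinom R m.
Proof.
rewrite divr_gt0// ltr0n ?fact_gt0// /mi_fact prodn_gt0// => j.
exact: fact_gt0.
Qed.

Lemma mpow_neq0 p m : (forall j, (0 < m j)%N -> p 0 j != 0) -> mpow p m != 0.
Proof.
move=> h; apply/prodf_neq0 => j _; have [->|/h ?] := posnP (m j).
  by rewrite expr0 oner_neq0.
exact: expf_neq0.
Qed.

Lemma mpow1 p j : mpow p (mi1 j) = p 0 j.
Proof.
have e : (0 < mi1 j j)%N by rewrite ffunE eqxx.
by rewrite (mpow_pred _ e) mi_pred_mi1 mpow0 mulr1.
Qed.

Lemma multinom1 j : multinom R (mi1 j) = 1.
Proof.
have e : (0 < mi1 j j)%N by rewrite ffunE eqxx.
have := multinom_pred e; rewrite mi_pred_mi1 multinom0 mi_deg1 ffunE eqxx.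
by rewrite !mulr1.
Qed.

Lemma mi_twice_gt0 j : (0 < mi_twice j j)%N. Proof. by rewrite !ffunE eqxx. Qed.

Lemma mi_pred_twice j : mi_pred (mi_twice j) j = mi1 j.
Proof. by apply/ffunP => i; rewrite !ffunE; case: eqP. Qed.

Lemma mi_deg_twice j : mi_deg (mi_twice j) = 2%N.
Proof.
by have := mi_deg_pred (mi_twice_gt0 j); rewrite mi_pred_twice mi_deg1; lia.
Qed.

Lemma mpow_twice p j : mpow p (mi_twice j) = p 0 j ^+ 2.
Proof. by rewrite (mpow_pred _ (mi_twice_gt0 j)) mi_pred_twice mpow1. Qed.

Lemma multinom_twice j : multinom R (mi_twice j) = 1.
Proof.
have := multinom_pred (mi_twice_gt0 j); rewrite mi_pred_twice multinom1.
rewrite mi_deg_twice !ffunE eqxx mulr1 -[RHS]mul1r => /mulIf; apply.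
by rewrite pnatr_eq0.
Qed.

End MultiIndexFacts.

Section Dust.
Variables (R : realType) (q : nat).
Implicit Types (A B : mimset q) (a m : mindex q) (j k : 'I_q).

Lemma dust_pred m j : (0 < m j)%N ->
  dust m = ([mset mi1 j] `+` dust (mi_pred m j))%mset.
Proof.
move=> mj; rewrite /dust (bigD1 j)//= [in RHS](bigD1 j)//= msetDA; congr msetD.
  rewrite ffunE eqxx; apply/msetP => a; rewrite !msetE2 !msetnE.
  by case: eqP => // _; rewrite subn1 add1n prednK.
by apply: eq_bigr => i /negbTE ij; rewrite ffunE ij subn0.
Qed.

Lemma dust0 : dust (mi0 q) = mset0.
Proof. by rewrite /dust big1// => j _; rewrite ffunE msetn0. Qed.

Lemma mindex_ind (T : mindex q -> Prop) : T (mi0 q) ->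
  (forall m j, (0 < m j)%N -> T (mi_pred m j) -> T m) -> forall m, T m.
Proof.
move=> T0 TS m; have [n] := ubnP (mi_deg m); elim: n m => // n IHn m mn.
have [/mi_deg_eq0->//|m_gt0] := posnP (mi_deg m).
have [j mj] : exists j, (0 < m j)%N.
  apply/existsP; apply: contraLR m_gt0 => /existsPn h; rewrite -eqn0Ngt.
  by rewrite /mi_deg big1// => j _; apply/eqP; rewrite -leqn0 leqNgt h.
by apply: (TS _ j) => //; apply: IHn; rewrite mi_deg_pred// prednK.
Qed.

Lemma color_count_dust m j : color_count (dust m) j = m j.
Proof.
move: m; apply: mindex_ind; first by rewrite dust0 color_count0 ffunE.
move=> m k mk IH; rewrite (dust_pred mk) color_countD IH color_countn !ffunE.
by case: eqVneq mk => [->|_ _]; lia.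
Qed.

Lemma dustE m a : dust m a = (\sum_j (if a == mi1 j then m j else 0))%N.
Proof.
rewrite /dust (big_morph (fun A : mimset q => A a) (id1 := 0%N) (op1 := addn)).
- by apply: eq_bigr => j _; rewrite msetnE.
- by move=> A B; rewrite msetE2.
- by rewrite mset0E.
Qed.

Lemma dust_mi1 m j : dust m (mi1 j) = m j.
Proof.
rewrite dustE (bigD1 j)//= eqxx big1 ?addn0// => k /negbTE kj.
by case: eqP => // /mi1_inj e; rewrite e eqxx in kj.
Qed.

Lemma dust_mem m a : a \in dust m -> exists j, a = mi1 j.
Proof.
rewrite in_mset dustE => h; apply: contrapT => /forallNP none; move: h.
by rewrite big1// => j _; case: eqP => // /none.
Qed.

Lemma dust_mi0 m : dust m (mi0 q) = 0%N.
Proof.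
apply/eqP; rewrite mset_eq0; apply/negP => /dust_mem[j e].
by have := mi_deg1 j; rewrite -e mi_deg0.
Qed.

Lemma removal_msetDl A B a j : a \in A -> (0 < a j)%N ->
  removal (A `+` B)%mset a j = (removal A a j `+` B)%mset.
Proof.
move=> aA aj; rewrite !removalE//; apply/msetP => b; rewrite !msetE2 msetnE.
by move: aA; rewrite in_mset; case: eqP => [->|_]; lia.
Qed.

(** The Leibniz rule: a removed ball comes from one of the two parts. *)
Lemma removal_op_msetD j (phi : mimset q -> R) A B :
  removal_op j phi (A `+` B)%mset =
  removal_op j (fun C => phi (C `+` B)%mset) A +
  removal_op j (fun C => phi (A `+` C)%mset) B.
Proof.
rewrite /removal_op big_enum_msetD; congr (_ + _); apply: eq_big_seq => a aA.
  have [->|aj] := posnP (a j); first by rewrite !mul0r.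
  by rewrite removal_msetDl.
have [->|aj] := posnP (a j); first by rewrite !mul0r.
by rewrite msetDC removal_msetDl// msetDC.
Qed.

Lemma removal_op_color0 j (phi : mimset q -> R) A : color_count A j = 0%N ->
  removal_op j phi A = 0.
Proof.
move=> A0; rewrite /removal_op big_seq big1// => a /(color_count_ge j).
by rewrite A0 leqn0 => /eqP ->; rewrite mul0r.
Qed.

Lemma removal_op_dust j (phi : mimset q -> R) m : (0 < m j)%N ->
  removal_op j phi (dust m) = (m j)%:R * phi (dust (mi_pred m j)).
Proof.
move=> mj; rewrite /removal_op (sum_mset_single (a := mi1 j)).
  by rewrite dust_mi1 ffunE eqxx mul1r /removal eqxx (dust_pred mj) msetD1K.
move=> a /dust_mem[k ->] kj; rewrite ffunE; case: eqVneq => [e|_]; last by rewrite mul0r.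
by rewrite e eqxx in kj.
Qed.

End Dust.

(** * The law of the colour counts *)

Section ColorLaw.
Variables (R : realType) (q : nat).
Variables (P : nat -> mimset q -> R).
Hypothesis hP : chromatic_partition_structure P.
Implicit Types (m : mindex q) (j : 'I_q) (phi : mimset q -> R).

Let L := part_functional P.
Let coh_L : coherent L := coherent_part_functional hP.

Definition color_law m : R := expect (vpart m) (P (mi_deg m)) (fun=> 1).

Let on_vpart m phi : mimset q -> R := fun A => (`[< vpart m A >])%:R * phi A.

Lemma part_functional_ge0 n phi : (forall A, 0 <= phi A) -> 0 <= L n phi.
Proof.
by move=> phi0; apply: sumr_ge0 => A _; rewrite mulr_ge0//; case: (hP.1 n).
Qed.

Lemma part_functional1 n : L n (fun=> 1) = 1.
Proof.
rewrite /L /part_functional /expect; under eq_bigr do rewrite mulr1.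
by rewrite -fsbig_finite; [case: (hP.1 n)|exact: finite_cpart].
Qed.

Lemma expect_vpart m phi :
  expect (vpart m) (P (mi_deg m)) phi = L (mi_deg m) (on_vpart m phi).
Proof.
apply: expect_subset; first exact: finite_cpart.
exact: vpart_cpart.
Qed.

(** A partition with colour counts [m] arises from one with counts [m - e_j] by
adding a ball of colour [j]; this trades the colour-wise removal for the next draw. *)
Lemma expect_vpart_removal m j phi : (0 < m j)%N ->
  expect (vpart m) (P (mi_deg m)) (removal_op j phi) =
  (mi_deg m)%:R * draw j L (mi_deg m).-1 (on_vpart (mi_pred m j) phi).
Proof.
move=> mj; rewrite expect_vpart -{2}(prednK (mi_deg_gt0 mj)) drawE.
rewrite prednK ?(mi_deg_gt0 mj)//; apply: (coh_ext coh_L) => A [A0 _].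
by rewrite removal_op_vpart.
Qed.

Lemma color_law_draw m j : (0 < m j)%N ->
  (m j)%:R * color_law m =
  (mi_deg m)%:R * draw j L (mi_deg m).-1 (on_vpart (mi_pred m j) (fun=> 1)).
Proof.
move=> mj; rewrite -expect_vpart_removal// /color_law /expect mulr_sumr.
apply: eq_big_seq => A /(mem_fset_set_seq _ (finite_vpart m))/vpartE[_ h].
by rewrite removal_op1 h mulr1 mulrC.
Qed.

Lemma vpart0_cpart A : cpart 0%N A -> vpart (mi0 q) A.
Proof. by move=> /cpart_vpart[m /mi_deg_eq0 ->]. Qed.

Lemma color_law0 : color_law (mi0 q) = 1.
Proof.
rewrite /color_law expect_vpart mi_deg0 -[RHS](part_functional1 0).
by apply: (coh_ext coh_L) => A /vpart0_cpart h; rewrite /on_vpart asboolT ?mulr1.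
Qed.

Lemma color_law1 j : color_law (mi1 j) = draw j L 0 (fun=> 1).
Proof.
have := @color_law_draw (mi1 j) j; rewrite ffunE eqxx mi_pred_mi1 mi_deg1 => /(_ isT).
rewrite !mul1r => ->.
apply: (coh_ext (coherent_draw j coh_L)) => A /vpart0_cpart h.
by rewrite /on_vpart asboolT// mulr1.
Qed.

Lemma color_law2 j : color_law (mi_twice j) = draw j (draw j L) 0 (fun=> 1).
Proof.
have := color_law_draw (mi_twice_gt0 j).
rewrite mi_pred_twice mi_deg_twice !ffunE eqxx.
move=> /(mulfI _) -> /=; last by rewrite pnatr_eq0.
rewrite -[RHS]mul1r (drawE j (draw j L) 0).
apply: (coh_ext (coherent_draw j coh_L)) => A [A0 wA].
have := removal_op_vpart (fun=> 1 : R) A0 (_ : 0 < mi1 j j)%N.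
rewrite ffunE eqxx mi_pred_mi1 => /(_ isT) e.
transitivity (removal_op j (on_vpart (mi0 q) (fun=> 1)) A); last first.
  apply: (@eq_removal_op _ _ 0) => // B /vpart0_cpart h.
  by rewrite /on_vpart asboolT// mulr1.
rewrite /on_vpart e; case: asboolP => [/vpartE[_ h]|_]; last by rewrite !mul0r.
by rewrite removal_op1 h ffunE eqxx.
Qed.

End ColorLaw.

(** * From colour moments to partial exchangeability *)

Section IndependentColors.
Variables (R : realType) (q : nat).
Variables (P : nat -> mimset q -> R) (p : 'rV[R]_q).
Hypothesis hP : chromatic_partition_structure P.
Hypothesis p_simplex : simplex p.
Hypothesis first_moment : forall j, color_law P (mi1 j) = p 0 j.
Hypothesis second_moment : forall j, color_law P (mi_twice j) = p 0 j ^+ 2.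
Implicit Types (A B : mimset q) (m : mindex q) (j : 'I_q) (phi : mimset q -> R).

Let L := part_functional P.
Let on_vpart m phi : mimset q -> R := fun A => (`[< vpart m A >])%:R * phi A.

Lemma p_ge0 j : 0 <= p 0 j.
Proof. by case: p_simplex => /(_ j)/andP[]. Qed.

(** The two moment hypotheses say exactly that the defect has total mass
[p_j ^ 2 - 2 * p_j * p_j + p_j ^ 2 = 0]. *)
Lemma draw_independent n j phi : (forall A, 0 <= phi A <= 1) ->
  draw j L n phi = p 0 j * L n phi.
Proof.
apply: (draw_proportional (coherent_part_functional hP)); first exact: part_functional_ge0.
rewrite -(color_law2 hP) -(color_law1 hP) first_moment second_moment.
by rewrite /L (part_functional1 hP); lra.
Qed.

Lemma on_vpart01 m phi : (forall A, 0 <= phi A <= 1) ->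
  forall A, 0 <= on_vpart m phi A <= 1.
Proof.
by move=> h A; rewrite /on_vpart; case: asboolP => _; rewrite ?mul1r ?mul0r// lexx ler01.
Qed.

Lemma color_law_multinomial m : color_law P m = multinom R m * mpow p m.
Proof.
move: m; apply: mindex_ind => [|m j mj IH].
  by rewrite color_law0// multinom0 mpow0 mulr1.
apply: (mulfI (_ : (m j)%:R != 0)); first by rewrite pnatr_eq0 -lt0n.
rewrite (color_law_draw hP mj) draw_independent; last first.
  by apply: on_vpart01 => A; rewrite ler01 lexx.
rewrite -(mi_deg_pred mj) -[L _ _](expect_vpart P) -/(color_law P (mi_pred m j)) IH.
rewrite (mpow_pred p mj); have h := multinom_pred R mj.
transitivity ((multinom R m * (m j)%:R) * (p 0 j * mpow p (mi_pred m j))); last lra.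
by rewrite h; lra.
Qed.

(** The conditional expectation given the colour counts [m], since the
denominator is the probability of these counts. *)
Definition cond_functional m phi : R :=
  expect (vpart m) (P (mi_deg m)) phi / (multinom R m * mpow p m).

(** The coherence of the conditional laws for colours of positive probability:
the factor [p_j] of the independent draw is the one by which [p ^ m] and
[p ^ (m - e_j)] differ. *)
Lemma cond_functional_removal m j phi : (0 < m j)%N -> mpow p m != 0 ->
  (forall A, 0 <= phi A <= 1) ->
  cond_functional m (removal_op j phi) =
  (m j)%:R * cond_functional (mi_pred m j) phi.
Proof.
move=> mj pm phi01; rewrite /cond_functional.
rewrite (expect_vpart_removal hP _ mj) draw_independent; last exact: on_vpart01.
rewrite -(mi_deg_pred mj) -[L _ _](expect_vpart P); set e := expect _ _ _.
have pm' := pm; rewrite (mpow_pred _ mj) mulf_eq0 negb_or in pm'.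
case/andP: pm' => pj pm'.
have c0 : multinom R m * mpow p m != 0 by rewrite mulf_neq0// gt_eqF// multinom_gt0.
have c1 : multinom R (mi_pred m j) * mpow p (mi_pred m j) != 0.
  by rewrite mulf_neq0// gt_eqF// multinom_gt0.
apply/eqP; rewrite [in eqbRHS]mulrA eqr_div//; apply/eqP.
have h := multinom_pred R mj.
rewrite (mpow_pred _ mj).
transitivity (((mi_deg m)%:R * multinom R (mi_pred m j)) * (p 0 j * e * mpow p (mi_pred m j))).
  by lra.
by rewrite -h; lra.
Qed.

(** The part of the counts [m] that [P] can see, and the part in colours of
probability zero. *)
Definition colored m : mindex q := [ffun j => if p 0 j == 0 then 0%N else m j].
Definition uncolored m : mindex q := [ffun j => if p 0 j == 0 then m j else 0%N].

Lemma mpow_colored m : mpow p (colored m) != 0.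
Proof. by apply: mpow_neq0 => j; rewrite ffunE; case: ifP. Qed.

(** Conditioning on the visible counts and adding one singleton for each ball of
an invisible colour.  Any coherent rule for these balls would do; singletons are
removed with the weight [m_j / m_j = 1], which makes coherence immediate. *)
Definition pe_kernel m B : R :=
  cond_functional (colored m) (fun A => dirac_at R B (A `+` dust (uncolored m))%mset).

Lemma cond_functional_ge0 m phi : (forall A, 0 <= phi A) -> 0 <= cond_functional m phi.
Proof.
move=> phi0; rewrite divr_ge0//.
  by apply: sumr_ge0 => A _; rewrite mulr_ge0//; case: (hP.1 (mi_deg m)).
rewrite mulr_ge0 ?(ltW (multinom_gt0 _ _))//.
by rewrite /mpow prodr_ge0// => j _; rewrite exprn_ge0// p_ge0.
Qed.

Lemma eq_cond_functional m phi psi : (forall A, vpart m A -> phi A = psi A) ->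
  cond_functional m phi = cond_functional m psi.
Proof.
move=> e; congr (_ / _); apply: eq_expect; first exact: finite_vpart.
by move=> A /e ->.
Qed.

Lemma cond_functional1 m : mpow p m != 0 -> cond_functional m (fun=> 1) = 1.
Proof.
move=> pm; rewrite /cond_functional -/(color_law P m) color_law_multinomial mulfV//.
by rewrite mulf_neq0// gt_eqF// multinom_gt0.
Qed.

Lemma vpart_dust m A : vpart (colored m) A ->
  vpart m (A `+` dust (uncolored m))%mset.
Proof.
move=> /vpartE[A0 h]; apply/vpartE; split; first by rewrite msetE2 A0 dust_mi0.
move=> j; rewrite color_countD h color_count_dust !ffunE.
by case: ifP => _; rewrite ?addn0.
Qed.

Lemma sum_pe_kernel m (F : mimset q -> R) :
  \sum_(B \in vpart m) pe_kernel m B * F B =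
  cond_functional (colored m) (fun A => F (A `+` dust (uncolored m))%mset).
Proof.
rewrite fsbig_finite; last exact: finite_vpart.
rewrite /pe_kernel /cond_functional.
transitivity (\sum_(B <- fset_set (vpart m))
    \sum_(A <- fset_set (vpart (colored m)))
   P (mi_deg (colored m)) A / (multinom R (colored m) * mpow p (colored m)) *
    (F B * dirac_at R (A `+` dust (uncolored m))%mset B)).
  apply: eq_bigr => B _; rewrite -mulrA mulr_suml; apply: eq_bigr => A _.
  rewrite /dirac_at eq_sym; set c := _^-1; set x := (_ == _)%:R; lra.
rewrite exchange_big/= mulr_suml; apply: eq_big_seq => A.
move=> /(mem_fset_set_seq _ (finite_vpart _)) /vpart_dust mA.
rewrite -mulr_sumr -/(expect (vpart m) F (dirac_at R _)).
rewrite expect_dirac_at//; last exact: finite_vpart.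
by rewrite mulrAC.
Qed.

Lemma pe_kernel_structure : pe_partition_structure pe_kernel.
Proof.
split=> [m|m j B mj mB].
- split.
  + by move=> B; apply: cond_functional_ge0 => A; rewrite /dirac_at ler0n.
  + move=> B nB; rewrite /pe_kernel (@eq_cond_functional _ _ (fun=> 0 * 0)).
      rewrite /cond_functional /expect; under eq_bigr do rewrite mul0r mulr0.
      by rewrite big1_eq mul0r.
    move=> A /vpart_dust mA; rewrite /dirac_at mul0r; case: eqP => // e.
    by case: nB; rewrite -e.
  + under eq_fsbigr do rewrite -[pe_kernel _ _]mulr1.
    by rewrite (sum_pe_kernel m (fun=> 1)) cond_functional1// mpow_colored.
- under eq_fsbigr do rewrite down_kernel_colE.
  rewrite (sum_pe_kernel m (fun A => removal_op j (dirac_at R B) A / (m j)%:R)).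
  have mj0 : (m j)%:R != 0 :> R by rewrite pnatr_eq0 -lt0n.
  apply: (mulfI mj0).
  (* A ball of an invisible colour is removed from the added singletons, any other
     ball from the visible part. *)
  have split_color A : vpart (colored m) A ->
      (m j)%:R * (removal_op j (dirac_at R B) (A `+` dust (uncolored m))%mset / (m j)%:R) =
      if p 0 j == 0 then (m j)%:R * dirac_at R B (A `+` dust (uncolored (mi_pred m j)))%mset
      else removal_op j (fun C => dirac_at R B (C `+` dust (uncolored m))%mset) A.
    move=> /vpartE[_ h]; rewrite mulrCA mulfV// mulr1 removal_op_msetD.
    case: ifPn => pj.
      rewrite removal_op_color0 ?add0r; last by rewrite h ffunE pj.
      rewrite removal_op_dust; last by rewrite ffunE pj.
      rewrite ffunE pj; congr (_ * dirac_at R B (_ `+` dust _)%mset).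
      by apply/ffunP => i; rewrite !ffunE; case: ifP => //; case: eqP => // ->; rewrite pj.
    rewrite [X in _ + X]removal_op_color0 ?addr0//.
    by rewrite color_count_dust ffunE (negbTE pj).
  have scale c phi n : c * cond_functional n phi = cond_functional n (fun A => c * phi A).
    rewrite /cond_functional mulrA mulr_sumr; congr (_ / _).
    by apply: eq_bigr => A _; rewrite mulrCA.
  rewrite [X in _ = X]scale (eq_cond_functional split_color) /pe_kernel.
  case: (boolP (p 0 j == 0)) => pj /=.
    have -> : colored (mi_pred m j) = colored m.
      apply/ffunP => i; rewrite !ffunE; case: ifP => // pi.
      by case: (i =P j) => [ij|_]; rewrite ?subn0//; rewrite ij pj in pi.
    by rewrite scale.
  have -> : colored (mi_pred m j) = mi_pred (colored m) j.
    by apply/ffunP => i; rewrite !ffunE; case: ifP.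
  have -> : uncolored (mi_pred m j) = uncolored m.
    apply/ffunP => i; rewrite !ffunE; case: ifP => // pi; case: eqP => [e|]; rewrite ?subn0//.
    by rewrite -e pi in pj.
  rewrite cond_functional_removal ?mpow_colored//.
  + by rewrite ffunE (negbTE pj).
  + by rewrite ffunE (negbTE pj).
  + by move=> A; rewrite /dirac_at ler0n lern1 leq_b1.
Qed.

Lemma pe_kernel_representation : pe_representation P p pe_kernel.
Proof.
split=> //; first exact: pe_kernel_structure.
move=> n A nA; have [m mn mA] := cpart_vpart nA.
have Q0 (k : mindex q) : k != m -> pe_kernel k A = 0.
  move=> km; have [[_ supp _] _] := (pe_kernel_structure.1 k, tt).
  by apply: supp => /vpart_inj/(_ mA) e; rewrite e eqxx in km.
rewrite (fsbigE [:: m])//=; last 2 first.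
- by move=> k /=; rewrite inE => /eqP ->.
- by move=> k _; rewrite inE => /Q0 ->; rewrite mulr0.
rewrite big_cons big_nil addr0 ifT; last by rewrite inE.
rewrite -mn; have [pm|pm] := eqVneq (mpow p m) 0.
  (* Counts of probability zero: [P A] is at most the probability of its counts. *)
  rewrite pm mulr0 mul0r; apply: le_anti.
  have [P0 _ _] := hP.1 (mi_deg m); rewrite P0 andbT.
  rewrite -[leRHS](_ : color_law P m = 0); last by rewrite color_law_multinomial pm mulr0.
  rewrite /color_law expectE; last exact: finite_vpart.
  rewrite (fsbigD1 A)//=; last exact: finite_vpart.
  rewrite mulr1 lerDl fsumr_ge0// => B _; rewrite mulr1.
  exact: P0.
have pj j : p 0 j == 0 -> m j = 0%N.
  move=> /eqP pj; apply/eqP; rewrite -leqn0 leqNgt; apply: contra pm => mj.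
  by rewrite (mpow_pred _ mj) pj mul0r.
have -> : pe_kernel m A = cond_functional m (dirac_at R A).
  rewrite /pe_kernel.
  have -> : colored m = m by apply/ffunP => j; rewrite ffunE; case: ifP => // /pj ->.
  have -> : uncolored m = mi0 q.
    by apply/ffunP => j; rewrite !ffunE; case: ifP => // /pj.
  by apply: eq_cond_functional => B _; rewrite dust0 msetD0.
rewrite /cond_functional expect_dirac_at//; last exact: finite_vpart.
by rewrite mulrC divfK// mulf_neq0// gt_eqF// multinom_gt0.
Qed.

End IndependentColors.

(** * Consequences of a representation *)

Section Representation.
Variables (R : realType) (q : nat).
Implicit Types (P : nat -> mimset q -> R) (p : 'rV[R]_q).
Implicit Types (Q : mindex q -> mimset q -> R) (A : mimset q) (m : mindex q) (j : 'I_q).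

(** A partition determines its colour counts, so only one summand of the mixture
charges it. *)
Lemma pe_representation_vpart P p Q m A : pe_representation P p Q -> vpart m A ->
  P (mi_deg m) A = multinom R m * mpow p m * Q m A.
Proof.
move=> [_ [Qprob _] rep] mA; rewrite rep; last exact: vpart_cpart.
rewrite (fsbigE [:: m])//=; last 2 first.
- by move=> k /=; rewrite inE => /eqP ->.
- move=> k _; rewrite inE => km; have [_ supp _] := Qprob k.
  rewrite supp ?mulr0// => /vpart_inj/(_ mA) e.
  by rewrite e eqxx in km.
by rewrite big_cons big_nil addr0 ifT// inE.
Qed.

Lemma pe_representation_color_law P p Q m : pe_representation P p Q ->
  color_law P m = multinom R m * mpow p m.
Proof.
move=> rep; have [_ [/(_ m)[_ _ Q1] _] _] := rep.
rewrite -[RHS]mulr1 -Q1 fsbig_finite; last exact: finite_vpart.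
rewrite mulr_sumr; apply: eq_big_seq => A /(mem_fset_set_seq _ (finite_vpart _)) mA.
by rewrite mulr1; exact: pe_representation_vpart.
Qed.

Lemma vpart_mi0 A : vpart (mi0 q) A -> A = mset0.
Proof.
move=> /vpartE[A0 h]; apply/msetP => a; rewrite mset0E; apply/eqP.
rewrite mset_eq0; apply/negP => aA.
have a0 : a = mi0 q.
  apply/ffunP => k; have := color_count_ge k aA; rewrite h !ffunE leqn0.
  by move/eqP.
by move: aA; rewrite a0 in_mset A0.
Qed.

Lemma vpart_removal_cases m j A : vpart m A -> (0 < m j)%N ->
  exists2 a : mindex q, (0 < a j)%N & vpart (mi_pred m j) (removal A a j) /\
    A = (a +` (A `\` [mset a]))%mset.
Proof.
move=> /[dup] /vpartE[A0 h] mA mj.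
have [a aA aj] : exists2 a, a \in A & (0 < a j)%N.
  by apply: color_count_pos; rewrite h.
by exists a => //; split; [apply/vpart_removal|rewrite msetB1K].
Qed.

Lemma mset_add_eq0 (A B : mimset q) : (A `+` B)%mset = mset0 -> A = mset0.
Proof.
move=> /msetP e; apply/msetP => a; have := e a; rewrite msetE2 mset0E.
by move/eqP; rewrite addn_eq0 => /andP[/eqP].
Qed.

Lemma mset1_neq0 (a : mindex q) : [mset a]%mset <> mset0 :> mimset q.
Proof. by move/msetP/(_ a); rewrite msetnxx mset0E. Qed.

Lemma mi_pred_inj (a b : mindex q) j : (0 < a j)%N -> (0 < b j)%N ->
  mi_pred a j = mi_pred b j -> a = b.
Proof.
move=> aj bj /ffunP e; apply/ffunP => k; have := e k; rewrite !ffunE.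
case: eqVneq => [->|_]; last by rewrite !subn0.
by rewrite !subn1; move: aj bj; case: (a j) (b j) => [|?] [|?] //= _ _ ->.
Qed.

Lemma vpart_msetn n j (m : mindex q) : (forall k, m k = n * mi1 j k)%N ->
  vpart m (msetn n (mi1 j)).
Proof.
move=> h; apply/vpartE; split=> [|k]; last by rewrite color_countn h.
by rewrite msetnE; case: eqP => // e; have := mi_deg1 j; rewrite -e mi_deg0.
Qed.

Lemma vpart_mi1 j : vpart (mi1 j) = [set [mset mi1 j]%mset].
Proof.
apply/seteqP; split=> A /=; last first.
  by move=> ->; apply: vpart_msetn => k; rewrite mul1n.
move=> /(@vpart_removal_cases _ j); rewrite ffunE eqxx => /(_ isT)[a aj [+ e]].
rewrite mi_pred_mi1 => /vpart_mi0; rewrite /removal; case: eqP => [aE|_] r0.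
  by rewrite e r0 msetD0 aE.
by move: r0; rewrite msetDC => /mset_add_eq0/mset1_neq0.
Qed.

Lemma vpart_twice j : vpart (mi_twice j) =
  [set msetn 2 (mi1 j); [mset mi_twice j]%mset].
Proof.
apply/seteqP; split=> A /=; last first.
  move=> [] ->; first by apply: vpart_msetn => k; rewrite !ffunE.
  apply/vpartE; split=> [|k]; last by rewrite color_countn mul1n.
  by rewrite msetnE; case: eqP => // E; have := mi_deg_twice j; rewrite -E mi_deg0.
move=> /(@vpart_removal_cases _ j) /(_ (mi_twice_gt0 j))[a aj [+ e]].
rewrite mi_pred_twice vpart_mi1 /= /removal; case: eqP => [aE|_] r1.
  left; rewrite e r1 aE; apply/msetP => b; rewrite !msetE2 !msetnE.
  by case: eqP.
right; have pa : mi_pred a j = mi1 j.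
  apply/eqP; rewrite -in_mset1 -r1 in_mset msetE2.
  by rewrite msetnxx addn1.
have aE : a = mi_twice j.
  by apply: mi_pred_inj aj (mi_twice_gt0 j) _; rewrite pa mi_pred_twice.
rewrite e aE; suff -> : (A `\` [mset mi_twice j])%mset = mset0 by rewrite msetD0.
rewrite -aE; apply/msetP => b; have /msetP/(_ b) := r1.
by rewrite pa !msetE2 mset0E; lia.
Qed.

Lemma color_law_mi1 P j : color_law P (mi1 j) = P 1%N [mset mi1 j]%mset.
Proof.
rewrite /color_law expectE; last exact: finite_vpart.
by rewrite vpart_mi1 fsbig_set1 mulr1 mi_deg1.
Qed.

Lemma color_law_twice P j : color_law P (mi_twice j) =
  P 2%N (msetn 2 (mi1 j)) + P 2%N [mset mi_twice j]%mset.
Proof.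
rewrite /color_law expectE; last exact: finite_vpart.
rewrite vpart_twice fsbigU0//=; first by rewrite !fsbig_set1 !mulr1 mi_deg_twice.
by move=> A [/= -> /msetP/(_ (mi1 j))]; rewrite !msetnE eqxx; case: ifP.
Qed.

(** If [p_j = 0], then moving from [p] slightly away from the vertex [e_j] stays in
the affine hull but makes the coordinate [j] negative. *)
Lemma relative_interior_simplex p : relative_interior (@simplex R q) p ->
  forall j, 0 < p 0 j.
Proof.
move=> [ps near_p] j; have [p01 p1] := ps.
have /andP[pj0 _] := p01 j; rewrite lt_neqAle pj0 andbT eq_sym; apply/eqP => pj.
pose y (e : R) : 'rV[R]_q := (1 + e) *: p - e *: delta_mx 0 j.
have y0 : y 0 = p by rewrite /y addr0 scale1r scale0r subr0.
have cy : y e @[e --> (0 : R)] --> y 0.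
  apply: cvgB; apply: cvgZr_tmp.
    by apply: cvgD; [exact: cvg_cst|exact: cvg_id].
  exact: cvg_id.
move: near_p; rewrite -{1}y0 => /cy /= /nbhs_ballP[e /= e0 sub].
have := sub (e / 2); rewrite /ball/= sub0r normrN gtr0_norm ?divr_gt0//.
rewrite ltr_pdivrMr// ltr_pMr// ltr1n => /(_ isT).
set t := e / 2; have t0 : 0 < t by rewrite divr_gt0.
case.
  exists 2%N, (fun i => if i == ord0 then 1 + t else - t),
    (fun i => if i == ord0 then p else delta_mx 0 j); split.
  - move=> i; case: ifP => // _; split.
      by move=> k; rewrite mxE !eqxx; case: eqP => _; rewrite lexx ler01.
    rewrite /l1norm (bigD1 j)//= mxE !eqxx normr1 big1 ?addr0// => k /negbTE kj.
    by rewrite mxE kj andbF normr0.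
  - by rewrite big_ord_recl big_ord1/=; lra.
  - by rewrite big_ord_recl big_ord1/= /y scaleNr.
move=> /(_ j)/andP[+ _] _; rewrite /y !mxE !eqxx pj mulr0 mulr1 sub0r.
by rewrite oppr_ge0 leNgt t0.
Qed.

End Representation.

(** * The sampling functions of one and two balls *)

Section PairSums.
Variable R : realType.
Local Open Scope ereal_scope.

Lemma esumZl (D : pred nat) (c : R) (f : nat -> \bar R) :
  (forall i, D i -> 0 <= f i) -> (0 <= c)%R ->
  c%:E * (\esum_(i in [set i | D i]) f i) = \esum_(i in [set i | D i]) (c%:E * f i).
Proof.
move=> f0 c0; rewrite -!nneseries_esum//; last by move=> i /f0; apply: mule_ge0.
by rewrite nneseriesZl// => i _; exact: f0.
Qed.

(** Splitting the double sum into its off-diagonal and its diagonal part. *)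
Lemma esum_square (D : pred nat) (f : nat -> R) :
  (forall i, D i -> (0 <= f i)%R) -> \esum_(i in [set i | D i]) (f i)%:E < +oo ->
  (\esum_(i in [set i | D i]) (f i)%:E) * (\esum_(i in [set i | D i]) (f i)%:E) =
  \esum_(z in [set z : nat * nat | [/\ D z.1, D z.2 & z.1 <> z.2]]) (f z.1 * f z.2)%:E
  + \esum_(i in [set i | D i]) (f i ^+ 2)%:E.
Proof.
move=> f0 fin; set T := \esum_(i in _) _ in fin *.
have T0 : 0 <= T by apply: esum_ge0 => i /f0; rewrite lee_fin.
have [t tE] : exists t, T = t%:E by exists (fine T); rewrite fineK// ge0_fin_numE.
have t0 : (0 <= t)%R by rewrite -lee_fin -tE.
transitivity (\esum_(i in [set i | D i]) \esum_(k in [set i | D i]) (f i * f k)%:E).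
  have fE0 i : D i -> 0 <= (f i)%:E by move=> /f0; rewrite lee_fin.
  rewrite {1}tE /T (esumZl fE0 t0); apply: eq_esum => i Di.
  by rewrite muleC -tE /T (esumZl fE0 (f0 _ Di)).
rewrite esum_esum; last by move=> i k Di Dk; rewrite lee_fin mulr_ge0// f0.
rewrite (esumID [set z | z.1 <> z.2]); last first.
  by move=> z [Di Dk]; rewrite lee_fin mulr_ge0// f0.
congr (_ + _).
  by congr (esum _ _); apply/seteqP; split=> -[i k] /=; [case=> -[]|case].
rewrite (reindex_esum [set i | D i] _ (fun i => (i, i)))//.
split=> [i Di /=||[i k] [/= [Di Dk] /contrapT ik]].
- by split=> //; apply.
- by move=> i k _ _ [].
- by exists i => //; rewrite -ik.
Qed.

End PairSums.

Section InjectiveSums.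
Variables (R : realType) (f : nat -> R).
Local Open Scope ereal_scope.

Lemma esum_inj_pos0 :
  \esum_(iota in @inj_pos 0) (\prod_(h < 0) f (iota h))%:E = 1.
Proof.
have -> : @inj_pos 0 = [set [ffun=> 0%N]].
  apply/seteqP; split=> iota /= _; first by apply/ffunP => -[].
  by split=> -[].
by rewrite esum_set1 big_ord0// lee01.
Qed.

Lemma esum_inj_pos1 :
  \esum_(iota in @inj_pos 1) (\prod_(h < 1) f (iota h))%:E =
  \esum_(i in [set i | (0 < i)%N]) (f i)%:E.
Proof.
rewrite (reindex_esum [set i | (0 < i)%N] _ (fun i => [ffun=> i])).
  by apply: eq_esum => i _; rewrite big_ord1 ffunE.
split.
- move=> i /= i0; split=> [h k _|h]; first by rewrite !ord1.
  by rewrite ffunE.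
- by move=> i k _ _ /ffunP/(_ ord0); rewrite !ffunE.
- move=> iota [_ pos]; exists (iota ord0); first exact: pos.
  by apply/ffunP => h; rewrite ffunE !ord1.
Qed.

Lemma esum_inj_pos2 :
  \esum_(iota in @inj_pos 2) (\prod_(h < 2) f (iota h))%:E =
  \esum_(z in [set z : nat * nat | [/\ (0 < z.1)%N, (0 < z.2)%N & z.1 <> z.2]])
    (f z.1 * f z.2)%:E.
Proof.
rewrite (reindex_esum [set z : nat * nat | [/\ (0 < z.1)%N, (0 < z.2)%N & z.1 <> z.2]]
  _ (fun z => [ffun h : 'I_2 => if h == ord0 then z.1 else z.2])).
  by apply: eq_esum => z _; rewrite big_ord_recl big_ord1 !ffunE.
split.
- move=> [i k] /= [i0 k0 ik]; split=> [h l|h]; rewrite !ffunE; last by case: ifP.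
  case: eqVneq => [->|h0]; case: eqVneq => [->|l0] // e.
  + by case: ik; rewrite e.
  + by move: h h0 l l0 {e} => [[|[|?]] //= ?] _ [[|[|?]] //= ?] _; exact: val_inj.
- move=> [i k] [i' k'] _ _ /ffunP e; have := e ord0; have := e ord_max.
  by rewrite !ffunE /= => -> ->.
- move=> iota [inj pos]; exists (iota ord0, iota ord_max).
    by split=> //= /inj.
  apply/ffunP => h; rewrite ffunE /=; case: eqVneq => [->//|].
  by case: h => [[|[|?]] //= ?] _; congr (iota _); exact: val_inj.
Qed.

End InjectiveSums.

Section SmallKernels.
Variables (R : realType) (q : nat).
Implicit Types (A : mimset q) (a m : mindex q) (j k : 'I_q) (x : nabla R q).

Lemma phi_msetn r a x :
  phi (msetn r a) x =
  (((r * mi_deg a)`!%:R / (mi_fact a ^ r * r`!)%N%:R)%:E *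
   \esum_(iota in @inj_pos r) (\prod_(h < r) mpow (val x (iota h)) a)%:E)%E.
Proof.
have nb : nblocks (msetn r a) = r by rewrite /nblocks -size_mset enum_msetn size_nseq.
have bs h : (h < r)%N -> nth (mi0 q) (block_seq (msetn r a)) h = a.
  move=> hr; have : nth (mi0 q) (block_seq (msetn r a)) h \in block_seq (msetn r a).
    by apply: mem_nth; rewrite size_sort enum_msetn size_nseq.
  by rewrite mem_sort enum_msetn mem_nseq => /andP[_ /eqP].
rewrite /phi; congr (_%:E * _)%E; last first.
  move: bs; rewrite nb => bs; apply: eq_esum => iota _; congr _%:E.
  by apply: eq_bigr => h _; rewrite bs.
rewrite weightE; under eq_bigr do rewrite color_countn.
rewrite -big_distrr/=; congr (_ * _); rewrite finsupp_msetn.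
case: r {nb bs} => [|r]; first by rewrite big_nil expn0 mul1n invr1.
by rewrite big_seq_fset1 msetnxx.
Qed.

Definition block_sum (f : nat -> R) : \bar R :=
  (\esum_(i in [set i | (0 < i)%N]) (f i)%:E)%E.

Definition pair_sum (f : nat -> R) : \bar R :=
  (\esum_(z in [set z : nat * nat | [/\ (0 < z.1)%N, (0 < z.2)%N & z.1 <> z.2]])
    (f z.1 * f z.2)%:E)%E.

Definition color_mass x j (i : nat) : R := val x i 0 j.

Lemma color_mass_ge0 x j i : 0 <= color_mass x j i.
Proof. by have := valP x; rewrite inE /color_mass => -[]. Qed.

Lemma mi_fact1 j : mi_fact (mi1 j) = 1%N.
Proof. by rewrite /mi_fact big1// => i _; rewrite ffunE; case: eqP. Qed.

Lemma phi_mset0 x : phi mset0 x = 1%E.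
Proof.
rewrite -(msetn0 (mi0 q)) phi_msetn mul0n expn0 mul1n divr1 mul1e.
exact: (esum_inj_pos0 (fun i => mpow (val x i) (mi0 q))).
Qed.

Lemma phi_mset1 a x : phi [mset a]%mset x =
  ((multinom R a)%:E * block_sum (fun i => mpow (val x i) a))%E.
Proof. by rewrite phi_msetn mul1n expn1 muln1 (esum_inj_pos1 (fun i => mpow (val x i) a)). Qed.

Lemma phi_msetn2 j x : phi (msetn 2 (mi1 j)) x = pair_sum (color_mass x j).
Proof.
rewrite phi_msetn mi_deg1 mi_fact1 exp1n mul1n muln1 divff ?mul1e; last first.
  by rewrite pnatr_eq0.
rewrite -[RHS]esum_inj_pos2; apply: eq_esum => iota _; congr _%:E.
by apply: eq_bigr => h _; rewrite mpow1.
Qed.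

Lemma phi_mi1 j x : phi [mset mi1 j]%mset x = block_sum (color_mass x j).
Proof.
rewrite phi_mset1 multinom1 mul1e; apply: eq_esum => i _; congr _%:E.
exact: mpow1.
Qed.

Lemma phi_twice j x :
  phi [mset mi_twice j]%mset x = block_sum (fun i => (color_mass x j i ^+ 2)%R).
Proof.
rewrite phi_mset1 multinom_twice mul1e; apply: eq_esum => i _; congr _%:E.
exact: mpow_twice.
Qed.

Definition mi_scale n j : mindex q := [ffun i => (n * mi1 j i)%N].

Lemma dust_scale n j : dust (mi_scale n j) = msetn n (mi1 j).
Proof.
rewrite /dust (bigD1 j)//= big1 ?msetD0 => [|k /negbTE kj].
  by rewrite !ffunE eqxx muln1.
by rewrite !ffunE kj muln0 msetn0.
Qed.

Lemma mi_scale_deg n j : mi_deg (mi_scale n j) = n.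
Proof.
rewrite /mi_deg; under eq_bigr do rewrite ffunE.
by rewrite -big_distrr/= -/(mi_deg _) mi_deg1 muln1.
Qed.

Lemma mi_scale_fact n j : mi_fact (mi_scale n j) = n`!.
Proof.
rewrite /mi_fact (bigD1 j)//= big1 => [|k /negbTE kj].
  by rewrite !ffunE eqxx !muln1.
by rewrite !ffunE kj muln0.
Qed.

Lemma mpow_scale (u : 'rV[R]_q) n j : mpow u (mi_scale n j) = u 0 j ^+ n.
Proof.
rewrite /mpow (bigD1 j)//= big1 => [|k /negbTE kj].
  by rewrite !ffunE eqxx muln1 mulr1.
by rewrite !ffunE kj muln0 expr0.
Qed.

Lemma dust_sub_msetn m n j : (dust m `<=` msetn n (mi1 j))%mset ->
  exists2 k, (k <= n)%N & m = mi_scale k j.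
Proof.
move=> /msubsetP sub; exists (m j).
  by have := sub (mi1 j); rewrite dust_mi1 msetnxx.
apply/ffunP => k; have := sub (mi1 k); rewrite dust_mi1 msetnE !ffunE.
have [->|kj] := eqVneq k j; first by rewrite eqxx muln1.
by case: eqP => [/mi1_inj e|_]; [rewrite e eqxx in kj|rewrite leqn0 muln0 => /eqP].
Qed.

(** Among [n] singletons of one colour, [i] may come from the dust; all other dust
vectors would exceed the partition. *)
Lemma psi_msetn (n : nat) j x : psi (msetn n (mi1 j)) x =
  (n`!%:R%:E * \sum_(0 <= i < n.+1) (color_mass x j 0%N ^+ i / (i`! * (n - i)`!)%N%:R)%:E *
     phi (msetn (n - i)%N (mi1 j)) x)%E.
Proof.
have wn : weight (msetn n (mi1 j)) = n.
  rewrite weightE; under eq_bigr do rewrite color_countn.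
  by rewrite -big_distrr/= -/(mi_deg _) mi_deg1 muln1.
rewrite /psi wn; congr (_ * _)%E.
rewrite (fsbigE [seq mi_scale i j | i <- index_iota 0 n.+1]).
- rewrite big_map; rewrite big_mkcond; apply: eq_big_nat => k /andP[_ kn].
  have sub : (dust (mi_scale k j) `<=` msetn n (mi1 j))%mset.
    by apply/msubsetP => a; rewrite dust_scale !msetnE; case: ifP.
  rewrite ifT ?inE//= mi_scale_fact mi_scale_deg mpow_scale dust_scale.
  congr (_ * phi _ _)%E; apply/msetP => a; rewrite msetE2 !msetnE.
  by case: ifP; rewrite ?subnn.
- rewrite map_inj_uniq ?iota_uniq// => k l /(congr1 (@mi_deg q)).
  by rewrite !mi_scale_deg.
- move=> m /mapP[k]; rewrite mem_index_iota => /andP[_ kn] ->.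
  by apply/msubsetP => a; rewrite dust_scale !msetnE; case: ifP.
- move=> m /dust_sub_msetn[k kn ->] /mapP[]; exists k => //.
  by rewrite mem_index_iota.
Qed.

Lemma psi_mi1 j x : psi [mset mi1 j]%mset x =
  ((color_mass x j 0%N)%:E + block_sum (color_mass x j))%E.
Proof.
rewrite psi_msetn big_nat_recl// big_nat1 !subn0 subnn msetn0 phi_mset0 phi_mi1.
by rewrite fact0 expr0 expr1 !divr1 mule1 !mul1e addeC.
Qed.

Lemma psi_twice j x : psi [mset mi_twice j]%mset x =
  block_sum (fun i => (color_mass x j i ^+ 2)%R).
Proof.
have wn : weight [mset mi_twice j]%mset = 2%N.
  rewrite weightE; under eq_bigr do rewrite color_countn mul1n.
  by rewrite -/(mi_deg _) mi_deg_twice.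
rewrite /psi wn (fsbigE [:: mi0 q])//=.
- rewrite big_cons big_nil adde0 ifT; last by rewrite inE /= dust0 msub0set.
  rewrite mi_deg0 subn0 dust0 msetB0 phi_twice mpow0.
  rewrite (_ : mi_fact (mi0 q) = 1%N); last by rewrite /mi_fact big1// => i _; rewrite ffunE.
  by rewrite mul1n muleA -EFinM mulrA mulr1 divff ?mul1e// pnatr_eq0.
- by move=> m /=; rewrite inE => /eqP ->; rewrite dust0 msub0set.
- move=> m /= /msubsetP sub; rewrite inE => /eqP m0; exfalso; apply: m0.
  apply/ffunP => k; have := sub (mi1 k); rewrite dust_mi1 msetnE ffunE.
  case: eqP => [e|_]; last by rewrite leqn0 => /eqP.
  by have := mi_deg1 k; rewrite e mi_deg_twice.
Qed.

Lemma l1norm_color_mass x i : l1norm (val x i) = \sum_j color_mass x j i.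
Proof. by apply: eq_bigr => j _; rewrite ger0_norm// color_mass_ge0. Qed.

Lemma color_mass_sum_lt_pinfty j x : (\sum_(i <oo) (color_mass x j i)%:E < +oo)%E.
Proof.
have := valP x; rewrite inE => -[_ _ x1].
apply: (@le_lt_trans _ _ 1%E); last by rewrite ltry.
rewrite -x1; apply: lee_nneseries => i _; first by rewrite lee_fin color_mass_ge0.
by rewrite lee_fin l1norm_color_mass (bigD1 j)//= lerDl sumr_ge0// => k _; exact: color_mass_ge0.
Qed.

Lemma total_colorE j x :
  ((total_color x 0 j)%:E = \sum_(i <oo) (color_mass x j i)%:E)%E.
Proof.
rewrite /total_color mxE summable_nneseries_lim//.
- by move=> i _; rewrite lee_fin color_mass_ge0.
- rewrite /summable (eq_esum (b := fun i => (color_mass x j i)%:E)); last first.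
    by move=> i _; rewrite gee0_abs// lee_fin color_mass_ge0.
  rewrite -nneseries_esum; first exact: color_mass_sum_lt_pinfty.
  by move=> i _; rewrite lee_fin color_mass_ge0.
Qed.

Lemma total_color_split j x :
  ((total_color x 0 j)%:E = (color_mass x j 0%N)%:E + block_sum (color_mass x j))%E.
Proof.
have c0 i : (0 <= (color_mass x j i)%:E)%E by rewrite lee_fin color_mass_ge0.
rewrite total_colorE nneseries_esumT// (esumID [set 0%N])// !setTI esum_set1//.
by congr (_ + esum _ _)%E; apply/seteqP; split=> -[|i] //=; case.
Qed.

Lemma block_sum_fin j x : exists2 t, block_sum (color_mass x j) = t%:E & 0 <= t.
Proof.
have := total_color_split j x; have : (0 <= block_sum (color_mass x j))%E.
  by apply: esum_ge0 => i _; rewrite lee_fin color_mass_ge0.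
by case: block_sum => [t| |]//; exists t.
Qed.

Lemma psi_mi1_total j x : psi [mset mi1 j]%mset x = (total_color x 0 j)%:E.
Proof. by rewrite psi_mi1 total_color_split. Qed.

(** Two balls of colour [j] lie in distinct blocks or in the same one.  With
[x_0] the dust and [t] the mass of the blocks, the two probabilities add up to
[x_0 ^ 2 + 2 * x_0 * t + t ^ 2 = D_j ^ 2]. *)
Lemma psi_two_balls j x : exists u v : R,
  [/\ psi (msetn 2 (mi1 j)) x = u%:E, psi [mset mi_twice j]%mset x = v%:E,
      0 <= u, 0 <= v & u + v = total_color x 0 j ^+ 2].
Proof.
have [t tE t0] := block_sum_fin j x.
have sq : (t%:E * t%:E = pair_sum (color_mass x j) + block_sum (fun i => (color_mass x j i ^+ 2)%R))%E.
  rewrite -tE; apply: (esum_square (D := ltn 0)).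
    by move=> i _; exact: color_mass_ge0.
  by rewrite -/(block_sum _) tE ltry.
have p0 : (0 <= pair_sum (color_mass x j))%E.
  by apply: esum_ge0 => z _; rewrite lee_fin mulr_ge0 ?color_mass_ge0.
have s0 : (0 <= block_sum (fun i => (color_mass x j i ^+ 2)%R))%E.
  by apply: esum_ge0 => z _; rewrite lee_fin sqr_ge0.
have := total_color_split j x; rewrite tE -EFinD => -[->].
rewrite psi_twice psi_msetn big_nat_recl// big_nat_recl// big_nat1.
rewrite !subn0 subnn subSnn msetn0 phi_mset0 phi_mi1 phi_msetn2 tE.
move: sq p0 s0; case: pair_sum => [u| |]//; case: block_sum => [v| |]// [sq].
rewrite !lee_fin => u0 v0.
exists (u + 2 * color_mass x j 0%N * t + color_mass x j 0%N ^+ 2), v; split=> //.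
- rewrite !mule1 expr0 expr1 -!EFinM; congr _%:E.
  by rewrite !(factS, fact0) !(muln1, mul1n); lra.
- have c0 := color_mass_ge0 x j 0.
  by rewrite !addr_ge0// ?sqr_ge0// !mulr_ge0.
- have -> : v = t * t - u by rewrite sq addrAC subrr add0r.
  by lra.
Qed.

End SmallKernels.

(** * Measurability of the total colour *)

Section TotalColor.
Variables (R : realType) (q : nat).
Implicit Types (j : 'I_q.+1).

Let X : measurableType _ := borel (nabla R q.+1).

Lemma continuous_color_mass j i : continuous (fun x : nabla R q.+1 => color_mass x j i).
Proof.
move=> x; apply: (@continuous_comp _ _ _ (fun x : nabla R q.+1 => val x i)
  (fun u : 'rV[R]_q.+1 => u 0 j)); last exact: coord_continuous.
apply: (@continuous_comp _ _ _ (fun x : nabla R q.+1 => val x)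
  (fun u : {ptws nat -> 'rV[R]_q.+1} => u i)); last exact: proj_continuous.
exact: initial_continuous.
Qed.

Lemma measurable_color_mass j i : measurable_fun [set: X] (fun x : X => color_mass x j i).
Proof.
apply: (measurability _ (RGenOInfty.measurableE R)) => _ [_ [a ->] <-].
rewrite setTI; apply: sub_sigma_algebra.
have : open (`]a, +oo[%classic : set R) by exact: interval_open.
by apply: open_comp => x _; exact: continuous_color_mass.
Qed.

Lemma measurable_block_sum (f : X -> nat -> R) : (forall x i, 0 <= f x i) ->
  (forall i, measurable_fun [set: X] (f ^~ i)) ->
  measurable_fun [set: X] (fun x => block_sum (f x)).
Proof.
move=> f0 mf.
have -> : (fun x => block_sum (f x)) =
    (fun x => \sum_(i <oo | i \in ltn 0%N) (f x i)%:E)%E.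
  apply/funext => x; rewrite nneseries_esum//.
  by move=> i _; rewrite lee_fin.
apply: ge0_emeasurable_sum => [i x _ _|i _]; first by rewrite lee_fin.
exact/measurable_EFinP.
Qed.

Lemma measurable_total_color_coord j :
  measurable_fun [set: X] (fun x : X => total_color x 0 j).
Proof.
apply/measurable_EFinP.
have -> : EFin \o (fun x : X => total_color x 0 j) =
    (fun x => (color_mass x j 0%N)%:E + block_sum (color_mass x j))%E.
  by apply/funext => x; exact: total_color_split.
apply: emeasurable_funD.
  by apply/measurable_EFinP; exact: (measurable_color_mass j 0).
apply: measurable_block_sum => [x i|i]; [exact: color_mass_ge0|exact: measurable_color_mass].
Qed.

Lemma total_color_ge0 x j : 0 <= total_color x 0 j :> R.
Proof.
by rewrite -lee_fin total_colorE nneseries_ge0// => i _ _; rewrite lee_fin color_mass_ge0.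
Qed.

(** The Borel sets of row vectors are generated by coordinates, because an open set
is a union of boxes with rational corners, of which there are countably many. *)
Lemma measurable_total_color :
  measurable_fun [set: X] (@total_color R q.+1 : X -> borel 'rV[R]_q.+1).
Proof.
pose O : set (set (borel 'rV[R]_q.+1)) := @open 'rV[R]_q.+1.
have mO : @measurable _ (borel 'rV[R]_q.+1) = <<s O >> by [].
apply: (measurability O mO) => _ [B oB <-]; rewrite setTI.
pose box (ab : {ffun 'I_q.+1 -> rat} * {ffun 'I_q.+1 -> rat}) : set 'rV[R]_q.+1 :=
  [set y | forall j, ratr (ab.1 j) < y 0 j < ratr (ab.2 j)].
pose U ab : set X := if `[< box ab `<=` B >] then @total_color R q.+1 @^-1` box ab else set0.
have -> : @total_color R q.+1 @^-1` B = \bigcup_ab U ab.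
  apply/seteqP; split=> x /=; last first.
    by move=> [ab _]; rewrite /U; case: asboolP => // sub /= /sub.
  move=> Bx; have /nbhs_ballP[e /= e0 sub] := open_nbhs_nbhs (conj oB Bx).
  set y := total_color x in Bx sub.
  have /choice[a aP] j : exists r, y 0 j - e < ratr r < y 0 j.
    have /rat_in_itvoo[r] : y 0 j - e < y 0 j by rewrite gtrBl.
    by rewrite in_itv/= => ?; exists r.
  have /choice[b bP] j : exists r, y 0 j < ratr r < y 0 j + e.
    have /rat_in_itvoo[r] : y 0 j < y 0 j + e by rewrite ltrDl.
    by rewrite in_itv/= => ?; exists r.
  exists (finfun a, finfun b) => //; rewrite /U asboolT /=; last first.
    move=> z /= zbox; apply: sub; split => // i j; rewrite (ord1 i) /ball/=.
    have := zbox j; rewrite /= !ffunE => /andP[za zb].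
    have /andP[? _] := aP j; have /andP[_ ?] := bP j.
    by rewrite ltr_distl; apply/andP; split; lra.
  by move=> j /=; rewrite !ffunE; have /andP[_ ->] := aP j; have /andP[-> _] := bP j.
apply: countable_bigcupT_measurable => [|ab]; first exact: countableP.
rewrite /U; case: ifP => _; last exact: measurable0.
have -> : @total_color R q.+1 @^-1` box ab = ~` (\bigcup_j
    ~` ((fun x : X => total_color x 0 j) @^-1` `](ratr (ab.1 j)), (ratr (ab.2 j))[%classic)).
  rewrite setC_bigcup; apply/seteqP; split => x /= h.
    by move=> j _; rewrite setCK /= in_itv/=; exact: h.
  by move=> j; have := h j Logic.I; rewrite setCK /= in_itv.
apply: measurableC; apply: countable_bigcupT_measurable => [|j]; first exact: countableP.
apply: measurableC; rewrite -[X in measurable X]setTI.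
by apply: measurable_total_color_coord => //; exact: measurable_itv.
Qed.

End TotalColor.

(** * Moments of the total colour *)

Section ColorMoments.
Variables (R : realType) (q : nat) (P : nat -> mimset q.+1 -> R).
Let X : measurableType _ := borel (nabla R q.+1).
Variable mu : probability X R.
Hypothesis hmu : represents mu P.
Implicit Types (j : 'I_q.+1) (p : 'rV[R]_q.+1).

Let D j (x : X) : R := total_color x 0 j.
Let mD j : measurable_fun [set: X] (D j) := @measurable_total_color_coord R q j.

Lemma cst_integral (c : R) : (\int[mu]_x (cst c%:E x) = c%:E)%E.
Proof.
by rewrite integral_cst// [X in (_ * X)%E]probability_setT mule1.
Qed.

Lemma color_law_mi1_integral j :
  ((color_law P (mi1 j))%:E = \int[mu]_x (D j x)%:E)%E.
Proof.
rewrite color_law_mi1 hmu.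
  by apply: eq_integral => x _; rewrite psi_mi1_total.
have : vpart (mi1 j) [mset mi1 j]%mset by rewrite vpart_mi1.
by move/vpart_cpart; rewrite mi_deg1.
Qed.

Lemma measurable_psi_twice j :
  measurable_fun [set: X] (fun x : X => psi [mset mi_twice j]%mset x).
Proof.
have -> : (fun x : X => psi [mset mi_twice j]%mset x) =
    (fun x : X => block_sum (fun i => color_mass x j i ^+ 2)).
  by apply/funext => x; exact: psi_twice.
apply: measurable_block_sum => [x i|i]; first exact: sqr_ge0.
by apply: measurable_funX; exact: measurable_color_mass.
Qed.

Lemma color_law_twice_integral j :
  ((color_law P (mi_twice j))%:E = \int[mu]_x (D j x ^+ 2)%:E)%E.
Proof.
rewrite color_law_twice EFinD.
have c2 A : vpart (mi_twice j) A -> cpart 2 A.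
  by move/vpart_cpart; rewrite mi_deg_twice.
rewrite !hmu; last 2 first.
- by apply: c2; rewrite vpart_twice; right.
- by apply: c2; rewrite vpart_twice; left.
have psi2E : (fun x : X => psi (msetn 2 (mi1 j)) x) =
    (fun x : X => ((D j x ^+ 2)%:E - psi [mset mi_twice j]%mset x)%E).
  apply/funext => x; rewrite /D; have [u [v [-> -> _ _ <-]]] := psi_two_balls j x.
  by rewrite -EFinB addrK.
rewrite -ge0_integralD//.
- apply: eq_integral => x _; rewrite /D.
  by have [u [v [-> -> _ _ <-]]] := psi_two_balls j x.
- by move=> x _; have [u [v [-> _ u0 _ _]]] := psi_two_balls j x; rewrite lee_fin.
- rewrite [X in measurable_fun _ X]psi2E; apply: emeasurable_funB; last exact: measurable_psi_twice.
  by apply/measurable_EFinP; apply: measurable_funX; exact: mD.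
- by move=> x _; have [u [v [_ -> _ v0 _]]] := psi_two_balls j x; rewrite lee_fin.
- exact: measurable_psi_twice.
Qed.

(** The variance of [D_j] is zero.  Moving the cross term to the other side,
[(D_j - p_j) ^ 2 + 2 * p_j * D_j = D_j ^ 2 + p_j ^ 2], keeps every integrand
nonnegative. *)
Lemma ae_total_color p : (forall j, color_law P (mi1 j) = p 0 j) ->
  (forall j, color_law P (mi_twice j) = p 0 j ^+ 2) ->
  (forall j, 0 <= p 0 j) ->
  {ae mu, forall x : X, total_color x = p}.
Proof.
move=> m1 m2 p0.
have Dj j : {ae mu, forall x : X, D j x = p 0 j}.
  have mf : measurable_fun [set: X] (fun x => ((D j x - p 0 j) ^+ 2)%:E).
    apply/measurable_EFinP; apply: measurable_funX.
    by apply: measurable_funB; [exact: mD|exact: measurable_cst].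
  have : (\int[mu]_x `|((D j x - p 0 j) ^+ 2)%:E| = 0)%E.
    under eq_integral do rewrite gee0_abs ?lee_fin ?sqr_ge0//.
    have mD1 : measurable_fun [set: X] (fun x => (2 * p 0 j * D j x)%:E).
      by apply/measurable_EFinP; apply: measurable_funM => //; exact: mD.
    have E : (\int[mu]_x ((D j x - p 0 j) ^+ 2)%:E + (2 * p 0 j * p 0 j)%:E =
              (p 0 j ^+ 2)%:E + (p 0 j ^+ 2)%:E)%E.
      have -> : ((2 * p 0 j * p 0 j)%:E = \int[mu]_x (2 * p 0 j * D j x)%:E)%E.
        under eq_integral do rewrite EFinM.
        rewrite ge0_integralZl_EFin//.
        - by rewrite -color_law_mi1_integral m1 -EFinM.
        - by move=> x _; rewrite lee_fin total_color_ge0.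
        - by apply/measurable_EFinP; exact: mD.
        - by rewrite mulr_ge0.
      rewrite -ge0_integralD//; last 2 first.
      - by move=> x _; rewrite lee_fin sqr_ge0.
      - by move=> x _; rewrite lee_fin !mulr_ge0// total_color_ge0.
      have -> : ((p 0 j ^+ 2)%:E + (p 0 j ^+ 2)%:E =
          \int[mu]_x (D j x ^+ 2)%:E + \int[mu]_x (cst (p 0 j ^+ 2)%:E x))%E.
        by rewrite -color_law_twice_integral m2 cst_integral.
      rewrite -ge0_integralD//.
      - by apply: eq_integral => x _; rewrite /cst -!EFinD; congr _%:E; lra.
      - by move=> x _; rewrite lee_fin sqr_ge0.
      - by apply/measurable_EFinP; apply: measurable_funX; exact: mD.
      - by move=> x _; rewrite lee_fin sqr_ge0.
    have : (0 <= \int[mu]_x ((D j x - p 0 j) ^+ 2)%:E)%E.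
      by apply: integral_ge0 => x _; rewrite lee_fin sqr_ge0.
    move: E; case: (\int[mu]_x _)%E => [r| |]// [E] _.
    by congr _%:E; lra.
  move/(ae_eq_integral_abs _ measurableT mf).1; apply: filterS => x /= /(_ Logic.I) [].
  by move/eqP; rewrite sqrf_eq0 subr_eq0 => /eqP.
have : {ae mu, forall x : X, forall j, D j x = p 0 j} by exact: filter_forall.
by apply: filterS => x h; apply/rowP => j; exact: h.
Qed.

Lemma color_dirac_ae p : {ae mu, forall x : X, total_color x = p} -> color_dirac mu p.
Proof.
move=> aeD B mB; rewrite /pushforward.
have mDB (C : set (borel 'rV[R]_q.+1)) : measurable C ->
    measurable ((@total_color R q.+1 : X -> borel 'rV[R]_q.+1) @^-1` C).
  by move=> mC; rewrite -[X in measurable X]setTI; exact: measurable_total_color.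
have null (C : set (borel 'rV[R]_q.+1)) : measurable C -> ~ C p ->
    mu ((@total_color R q.+1 : X -> borel 'rV[R]_q.+1) @^-1` C) = 0%E.
  move=> mC nC; apply: measure_negligible; first exact: mDB.
  have neg : mu.-negligible (~` [set x : X | total_color x = p]) := aeD.
  by apply: negligibleS neg => x /= Cx e; apply: nC; rewrite -e.
rewrite diracE; have [Bp|nBp] := pselect (B p); last first.
  by rewrite memNset//; exact: null.
have mCB : measurable (~` B) by exact: measurableC.
have -> : (@total_color R q.+1 : X -> borel 'rV[R]_q.+1) @^-1` B =
    ~` ((@total_color R q.+1 : X -> borel 'rV[R]_q.+1) @^-1` (~` B)).
  by rewrite preimage_setC setCK.
have h : mu ((@total_color R q.+1 : X -> borel 'rV[R]_q.+1) @^-1` (~` B)) = 0%E.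
  by apply: null => //; apply.
by rewrite mem_set// probability_setC ?h ?sube0//; exact: mDB.
Qed.

Lemma ae_color_dirac p : color_dirac mu p -> {ae mu, forall x : X, total_color x = p}.
Proof.
move=> dirac_p.
have mp : measurable (~` [set p] : set (borel 'rV[R]_q.+1)).
  apply: sub_sigma_algebra; apply: closed_openC; apply: accessible_closed_set1.
  exact/hausdorff_accessible/norm_hausdorff.
have := dirac_p _ mp; rewrite diracE memNset; last by apply.
move=> null; exists ((@total_color R q.+1 : X -> borel 'rV[R]_q.+1) @^-1` (~` [set p])).
split=> //.
by rewrite -[X in measurable X]setTI; exact: measurable_total_color.
Qed.

Lemma color_law_ae p : {ae mu, forall x : X, total_color x = p} ->
  forall j, color_law P (mi1 j) = p 0 j /\ color_law P (mi_twice j) = p 0 j ^+ 2.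
Proof.
move=> aeD j.
split; apply: EFin_inj.
  rewrite color_law_mi1_integral -[RHS]cst_integral; apply: ae_eq_integral => //.
    by apply/measurable_EFinP; exact: mD.
  by apply: filterS aeD => x xp _; rewrite /D xp.
rewrite color_law_twice_integral -[RHS]cst_integral; apply: ae_eq_integral => //.
  by apply/measurable_EFinP; apply: measurable_funX; exact: mD.
by apply: filterS aeD => x xp _; rewrite /D xp.
Qed.

End ColorMoments.

Theorem proposition5p41 (R : realType) (q : nat)
    (P : nat -> mimset q.+1 -> R) (mu : probability (borel (nabla R q.+1)) R)
    (hP : chromatic_partition_structure P) (hmu : represents mu P) :
  [/\ pe_type P <-> exists2 p, simplex p & color_dirac mu p,
      forall p Q, pe_representation P p Q ->
        forall j, p 0 j = P 1%N [mset mi1 j]%mset,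
      forall p, simplex p -> color_dirac mu p ->
        forall j, p 0 j = P 1%N [mset mi1 j]%mset &
      forall p Q, pe_representation P p Q ->
        relative_interior (@simplex R q.+1) p ->
        forall m A, vpart m A ->
          Q m A = (multinom R m)^-1 * (mpow p m)^-1 * P (mi_deg m) A].
Proof.
split.
- split=> [[p [Q rep]]|[p ps /ae_color_dirac/(color_law_ae hmu) laws]].
    have [ps _ _] := rep; exists p => //; apply: color_dirac_ae.
    apply: (ae_total_color hmu) => j.
    + by rewrite (pe_representation_color_law _ rep) multinom1 mul1r mpow1.
    + by rewrite (pe_representation_color_law _ rep) multinom_twice mul1r mpow_twice.
    + by case: ps => /(_ j)/andP[].
  exists p, (pe_kernel P p).
  by apply: pe_kernel_representation => // j; case: (laws j).
- move=> p Q rep j; rewrite -color_law_mi1 (pe_representation_color_law _ rep).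
  by rewrite multinom1 mul1r mpow1.
- move=> p ps /ae_color_dirac/(color_law_ae hmu)/[swap] j /(_ j)[<- _].
  exact: color_law_mi1.
- move=> p Q rep p_int m A mA; rewrite (pe_representation_vpart rep mA).
  rewrite -invfM mulrA mulVf ?mul1r// mulf_neq0 ?gt_eqF ?multinom_gt0//.
  by rewrite /mpow prodr_gt0// => j _; rewrite exprn_gt0// relative_interior_simplex.
Qed.
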